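(* Let $S$ be a densely defined nonnegative symmetric operator in a separable complex Hilbert space $\mathfrak H$, and let $\widetilde S_0,\widetilde S_1$ be two nonnegative selfadjoint extensions of $S$ such that $\operatorname{dom}\widetilde S_1\cap\operatorname{dom}\widetilde S_0=\operatorname{dom}S$ and the form $\widetilde S_0[\cdot,\cdot]$ is a closed restriction of the form $\widetilde S_1[\cdot,\cdot]$. Let $\{\mathcal H,\Gamma_0\}$ be a boundary pair for $\{\widetilde S_0,\widetilde S_1\}$ and $\{\mathcal H,\Gamma_0,\Gamma_1\}$ the corresponding boundary triplet, let $\widetilde B_k=(I-\widetilde S_k)(I+\widetilde S_k)^{-1}$, $k=0,1$, and let $X_0$ be the continuous linear isomorphism from $\mathcal H$ onto $\mathfrak N=\ker(S^*+I)$ such that $\Gamma_0(-1)=(\widetilde B_1-\widetilde B_0)^{1/2}X_0$. Then the Weyl function $M(z)$ of the boundary triplet $\{\mathcal H,\Gamma_0,\Gamma_1\}$ takes the form $$M(z)=-2X_0^*\left(I+(\widetilde B_1-\widetilde B_0)^{1/2}\Big(\widetilde B_0-\tfrac{1-z}{1+z}I\Big)^{-1}(\widetilde B_1-\widetilde B_0)^{1/2}\right)X_0=-2X_0^*\,\widetilde Q_0\Big(\tfrac{1-z}{1+z}\Big)X_0,\quad z\in\mathbb C\setminus[0,\infty),$$ where $$\widetilde Q_0(\lambda)=\big[(\widetilde B_1-\widetilde B_0)^{1/2}(\widetilde B_0-\lambda I)^{-1}(\widetilde B_1-\widetilde B_0)^{1/2}+I\big]\upharpoonright\mathfrak N,\quad\lambda\in\mathbb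 C\setminus[-1,1].$$ If, in particular, the pair $\{\widetilde S_0,\widetilde S_1\}$ satisfies the properties: $\widetilde S_0\cap\widetilde S_1=S$, the form $\widetilde S_0[\cdot,\cdot]$ is a closed restriction of the form $\widetilde S_1[\cdot,\cdot]$, and $\inf\{\widetilde S_1[u-\varphi]:\varphi\in\mathcal D[\widetilde S_0]\}=0$ for all $u\in\mathcal D[\widetilde S_1]$, then $M(z)$ belongs to the class $\mathcal S_{\rm F}(\mathcal H)$.
   Context: For a nonnegative selfadjoint operator $T$: $\mathcal D[T]=\operatorname{dom}T^{1/2}$, $T[u,v]=(T^{1/2}u,T^{1/2}v)$, $T[u]=T[u,u]$. ''$\widetilde S_0[\cdot,\cdot]$ is a closed restriction of $\widetilde S_1[\cdot,\cdot]$'' means $\mathcal D[\widetilde S_0]\subset\mathcal D[\widetilde S_1]$ and the forms agree on $\mathcal D[\widetilde S_0]$. The space $\mathcal D[\widetilde S_1]$ is a Hilbert space with inner product $(u,v)_{\widetilde S_1}=\widetilde S_1[u,v]+(u,v)$, and $\mathcal D[\widetilde S_1]\ominus_{\widetilde S_1}\mathcal D[\widetilde S_0]$ is the orthogonal complement of $\mathcal D[\widetilde S_0]$ in it. Put $\mathcal L:=\operatorname{dom}\widetilde S_0\dotplus\big(\mathcal D[\widetilde S_1]\ominus_{\widetilde S_1}\mathcal D[\widetilde S_0]\big)$ (direct sum; $\mathcal L\subset\mathcal D[\widetilde S_1]\cap\operatorname{dom}S^*$) and $\widetilde{\mathfrak N}_z:=\ker(S^*-zI)\cap\mathcal L$ for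 $z\in\mathbb C\setminus[0,\infty)$. One has $\mathcal D[\widetilde S_1]=\mathcal D[\widetilde S_0]\dotplus\widetilde{\mathfrak N}_z$ and $\widetilde{\mathfrak N}_{-1}=\mathcal D[\widetilde S_1]\ominus_{\widetilde S_1}\mathcal D[\widetilde S_0]=\operatorname{ran}(\widetilde B_1-\widetilde B_0)^{1/2}$. A boundary pair for $\{\widetilde S_0,\widetilde S_1\}$ is a pair $\{\mathcal H,\Gamma_0\}$ where $\mathcal H$ is a Hilbert space and $\Gamma_0:\mathcal D[\widetilde S_1]\to\mathcal H$ is a continuous linear operator (with respect to $(\cdot,\cdot)_{\widetilde S_1}$) with $\ker\Gamma_0=\mathcal D[\widetilde S_0]$, $\operatorname{ran}\Gamma_0=\mathcal H$. Given a boundary pair there is a unique linear operator $\Gamma_1:\mathcal L\to\mathcal H$ such that $\widetilde S_1[u,v]=(S^*u,v)-(\Gamma_1u,\Gamma_0v)_{\mathcal H}$ for all $u\in\mathcal L$, $v\in\mathcal D[\widetilde S_1]$; $\{\mathcal H,\Gamma_0,\Gamma_1\}$ is the corresponding boundary triplet. The $\Gamma_0$-field is $\Gamma_0(z):=(\Gamma_0\upharpoonright\widetilde{\mathfrak N}_z)^{-1}$, regarded as an operator in $\mathbf L(\mathcal H,\mathfrak H)$, and the Weyl function is $M(z):=\Gamma_1\Gamma_0(z)$, $z\in\mathbb C\setminus[0,\infty)$. The isomorphism $X_0$ in the claim exists since $\operatorname{ran}\Gamma_0(-1)=\operatorname{ran}(\widetilde B_1-\widetilde B_0)^{1/2}$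 and $\overline{\operatorname{ran}}(\widetilde B_1-\widetilde B_0)^{1/2}=\mathfrak N$. At $z=-1$ the resolvent term in the formula is understood as $0$ (value at $\lambda=\infty$). $\mathcal S_{\rm F}(\mathcal H)$ is the class of $\mathbf L(\mathcal H)$-valued Herglotz–Nevanlinna functions $\mathcal M$ holomorphic on $\mathbb C\setminus[0,\infty)$ (i.e. $\mathcal M(\bar\lambda)=\mathcal M(\lambda)^*$, $\operatorname{Im}\lambda\cdot\operatorname{Im}\mathcal M(\lambda)\ge0$) such that: (1) $\mathcal M^{-1}(\lambda)\in\mathbf L(\mathcal H)$ for all $\lambda\in\mathbb C\setminus[0,\infty)$; (2) $s\text{-}\lim_{x\uparrow0}\mathcal M(x)=0$; (3) $\lim_{x\downarrow-\infty}(\mathcal M(x)g,g)=-\infty$ for each $g\ne0$; (4) $s\text{-}\lim_{x\downarrow-\infty}x^{-1}\mathcal M(x)=0$. *)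

(* Defs.v *)
From HB Require Import structures.
From mathcomp Require Import all_boot all_order all_algebra.
From mathcomp Require Import complex.
From mathcomp Require Import all_classical all_reals all_analysis.

Set Implicit Arguments.
Unset Strict Implicit.
Unset Printing Implicit Defensive.

Import Order.TTheory GRing.Theory Num.Theory.
Import numFieldNormedType.Exports.

Local Open Scope classical_set_scope.
Local Open Scope ring_scope.
Local Open Scope complex_scope.

(* The inner product is linear in its first argument and conjugate-linear in
   its second one. *)
Record hilbertSpace (R : realType) := HilbertSpace {
  hilbert_carrier :> completeNormedModType R[i] ;
  inner : {dot hilbert_carrier for @Num.conj R[i]} ;
  inner_norm : forall u : hilbert_carrier, inner u u = `|u| ^+ 2 }.

Definition separable (T : topologicalType) : Prop :=
  exists D : set T, countable D /\ dense D.

(* A (possibly unbounded, not everywhere defined) linear operator is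
   represented by its graph.  Hence the inclusion of graphs is the extension of
   operators, the equality of graphs is the equality of operators, including
   that of their domains, and products, sums and inverses have their natural
   domains. *)
Definition oper (R : realType) (U V : hilbertSpace R) : Type := set (U * V).

Section Operators.
Variable R : realType.
Implicit Types U V X : hilbertSpace R.

Definition linear_oper U V (T : oper U V) : Prop :=
  [/\ T (0, 0),
      forall (a : R[i]) u v u' v', T (u, v) -> T (u', v') ->
        T (a *: u + u', a *: v + v')
    & forall u v v', T (u, v) -> T (u, v') -> v = v'].

Definition oper_dom U V (T : oper U V) : set U := [set u | exists v, T (u, v)].
Definition oper_ran U V (T : oper U V) : set V := [set v | exists u, T (u, v)].
Definition oper_ker U V (T : oper U V) : set U := [set u | T (u, 0)].

(* The value T u, when u is in the domain of T; 0 otherwise. *)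
Definition oper_app U V (T : oper U V) (u : U) : V :=
  xget 0 [set v | T (u, v)].

Definition oper_zero U V : oper U V := [set p | p.2 = 0].
Definition oper_id U : oper U U := [set p | p.2 = p.1].
Definition oper_scale U V (a : R[i]) (T : oper U V) : oper U V :=
  [set p | exists2 v, T (p.1, v) & p.2 = a *: v].
Definition oper_add U V (S T : oper U V) : oper U V :=
  [set p | exists v w, [/\ S (p.1, v), T (p.1, w) & p.2 = v + w]].
Definition oper_comp U V X (S : oper V X) (T : oper U V) : oper U X :=
  [set p | exists2 v, T (p.1, v) & S (v, p.2)].
Definition oper_inv U V (T : oper U V) : oper V U := [set p | T (p.2, p.1)].
Definition oper_restr U V (T : oper U V) (D : set U) : oper U V :=
  [set p | D p.1 /\ T p].

Definition adjoint U V (T : oper U V) : oper V U :=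
  [set p | forall u v, T (u, v) -> inner V v p.1 = inner U u p.2].

(* T is an element of L(U, V). *)
Definition bounded_oper U V (T : oper U V) : Prop :=
  [/\ linear_oper T, oper_dom T = setT
    & exists k : R, forall u v, T (u, v) -> `|v| <= k%:C * `|u|].

Definition densely_defined U V (T : oper U V) : Prop := dense (oper_dom T).

Definition symmetric_oper U (T : oper U U) : Prop := T `<=` adjoint T.

Definition nonneg_oper U (T : oper U U) : Prop :=
  forall u v, T (u, v) -> 0 <= inner U v u.

Definition selfadjoint U (T : oper U U) : Prop :=
  [/\ linear_oper T, densely_defined T & adjoint T = T].

(* The nonnegative selfadjoint square root, which exists and is unique when T is
   a nonnegative selfadjoint operator (T is only a default value). *)
Definition oper_sqrt U (T : oper U U) : oper U U :=
  xget T [set A | [/\ selfadjoint A, nonneg_oper A & oper_comp A A = T]].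

End Operators.

Arguments oper_zero {R} U V.
Arguments oper_id {R} U.

Notation "A \+o B" := (oper_add A B) (at level 50, left associativity).
Notation "A \oc B" := (oper_comp A B) (at level 40, left associativity).
Notation "a \:o A" := (oper_scale a A) (at level 40, left associativity).
Notation "A \-o B" := (oper_add A (oper_scale (-1) B))
  (at level 50, left associativity).

Section Forms.
Variables (R : realType) (H : hilbertSpace R).
Implicit Types T : oper H H.

Definition form_dom T : set H := oper_dom (oper_sqrt T).

Definition form T (u v : H) : R[i] :=
  inner H (oper_app (oper_sqrt T) u) (oper_app (oper_sqrt T) v).

Definition qform T (u : H) : R := complex.Re (form T u u).

Definition form_inner T (u v : H) : R[i] := form T u v + inner H u v.

Definition closed_form_restriction T0 T1 : Prop :=
  form_dom T0 `<=` form_dom T1 /\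
  forall u v, form_dom T0 u -> form_dom T0 v -> form T0 u v = form T1 u v.

(* The orthogonal complement of D[T0] in the Hilbert space D[T1]. *)
Definition form_ortho T0 T1 : set H :=
  [set u | form_dom T1 u /\ forall v, form_dom T0 v -> form_inner T1 u v = 0].

Definition oper_cayley T : oper H H :=
  (oper_id H \-o T) \oc oper_inv (oper_id H \+o T).

End Forms.

Section BoundaryPairs.
Variables (R : realType) (H K : hilbertSpace R).
Implicit Types (S : oper H H) (G : oper H K) (z : R[i]).

Definition eigen_ker (T : oper H H) z : set H :=
  oper_ker (T \-o (z \:o oper_id H)).

Definition triplet_dom S0 S1 : set H :=
  [set u | exists v w, [/\ oper_dom S0 v, form_ortho S0 S1 w & u = v + w]].

Definition triplet_defect S S0 S1 z : set H :=
  eigen_ker (adjoint S) z `&` triplet_dom S0 S1.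

Definition boundary_pair S0 S1 G0 : Prop :=
  [/\ linear_oper G0 /\ oper_dom G0 = form_dom S1,
      exists k : R, forall u h, G0 (u, h) ->
        `|h| ^+ 2 <= k%:C * form_inner S1 u u,
      oper_ker G0 = form_dom S0
    & oper_ran G0 = setT].

Definition boundary_triplet S S0 S1 G0 G1 : Prop :=
  [/\ boundary_pair S0 S1 G0,
      linear_oper G1,
      oper_dom G1 = triplet_dom S0 S1
    & forall u v, triplet_dom S0 S1 u -> form_dom S1 v ->
        form S1 u v = inner H (oper_app (adjoint S) u) v
                      - inner K (oper_app G1 u) (oper_app G0 v)].

Definition gamma_field S S0 S1 G0 z : oper K H :=
  oper_inv (oper_restr G0 (triplet_defect S S0 S1 z)).

Definition weyl_function S S0 S1 G0 G1 z : oper K K :=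
  G1 \oc gamma_field S S0 S1 G0 z.

End BoundaryPairs.

Section QFunction.
Variables (R : realType) (H : hilbertSpace R).

(* The spectral parameter ranges over the Riemann sphere; None is the point at
   infinity, where the resolvent takes the value 0. *)
Definition resolvent (B : oper H H) (l : option R[i]) : oper H H :=
  if l is Some a then oper_inv (B \-o (a \:o oper_id H)) else oper_zero H H.

Definition cayley_point (z : R[i]) : option R[i] :=
  if z == -1 then None else Some ((1 - z) / (1 + z)).

Definition qfun_full (B0 B1 : oper H H) (l : option R[i]) : oper H H :=
  let W := oper_sqrt (B1 \-o B0) in
  oper_id H \+o (W \oc resolvent B0 l \oc W).

Definition qfun (N : set H) (B0 B1 : oper H H) (l : option R[i]) : oper H H :=
  oper_restr (qfun_full B0 B1 l) N.

End QFunction.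

(* z lies in C \ [0, +oo): in the order of R[i], 0 <= z holds exactly when z is
   real and nonnegative. *)
Definition off_halfline (R : realType) (z : R[i]) : Prop := ~ (0 <= z).

Section StieltjesClass.
Variables (R : realType) (K : hilbertSpace R).
Implicit Types M : R[i] -> oper K K.

(* Complex differentiability at z in the operator norm of L(K). *)
Definition holomorphic_at M (z : R[i]) : Prop :=
  exists2 D : oper K K, bounded_oper D &
    forall e : R, 0 < e -> exists2 d : R, 0 < d &
      forall w : R[i], 0 < `|w - z| < d%:C -> forall h : K,
        `|(w - z)^-1 *: (oper_app (M w) h - oper_app (M z) h) - oper_app D h|
          <= e%:C * `|h|.

Definition oper_im (A : oper K K) : oper K K :=
  (2 * 'i)^-1 \:o (A \-o adjoint A).

Definition herglotz_nevanlinna M : Prop :=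
  forall z, off_halfline z ->
    [/\ bounded_oper (M z),
        holomorphic_at M z,
        M (z^*)%R = adjoint (M z)
      & nonneg_oper ((complex.Im z)%:C \:o oper_im (M z))].

Definition class_SF M : Prop :=
  [/\ herglotz_nevanlinna M,
      forall z, off_halfline z -> bounded_oper (oper_inv (M z)),
      forall g : K, oper_app (M x%:C) g @[x --> (0 : R)^'-] --> (0 : K),
      forall g : K, g != 0 ->
        complex.Re (inner K (oper_app (M x%:C) g) g) @[x --> -oo%R] --> -oo%R
    & forall g : K,
        x%:C^-1 *: oper_app (M x%:C) g @[x --> -oo%R] --> (0 : K)].

End StieltjesClass.

(* Main.v *)
(* Let E be the orthogonal complement of D[S0] in D[S1] and gam : K -> E the
   inverse of Gamma_0 on E. A solution of S* u = z u with Gamma_0 u = h is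
   u(z) = gam h + (1 + z) (S0 - z)^-1 gam h, and the abstract Green identity gives
     (M(z) h, Gamma_0 v) = z (u(z), v) - S1[u(z), v]   for all v in D[S1].
   Everything follows from this identity:
   - (M(z) h, k) = (h, M(conj z) k), so M(z) is bounded by Hellinger-Toeplitz;
   - (M(z) h, h) = z |u|^2 - S1[u] is bounded below by c (S1[u] + |u|^2) in modulus,
     since z is off [0, +oo), and |h|^2 <= k (S1[u] + |u|^2): M(z) is invertible;
   - M(w) - M(z) = (w - z) u(conj z)^* u(w), whence holomorphy;
   - for t > 0, -(M(-t) h, h) is the minimum of S1[u] + t |u|^2 over Gamma_0 u = h,
     which yields the three limits;
   - M(-1) = -2 X0^* X0 and B1 - B0 = 2 ((S1 + 1)^-1 - (S0 + 1)^-1) turn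
     M(z) into the formula with the resolvent of B0. *)

Require Import Defs.
From HB Require Import structures.
From mathcomp Require Import all_boot all_order all_algebra.
From mathcomp Require Import complex ring lra.
From mathcomp Require Import all_classical all_reals all_analysis.

Set Implicit Arguments.
Unset Strict Implicit.
Unset Printing Implicit Defensive.

Import Order.TTheory GRing.Theory Num.Theory.
Import numFieldNormedType.Exports.
Import ComplexField.Normc.

Local Open Scope classical_set_scope.
Local Open Scope ring_scope.
Local Open Scope complex_scope.

(** * Hilbert spaces *)

Section HilbertBasics.
Variable R : realType.
Implicit Types (H : hilbertSpace R) (a b : R[i]) (t : R).

(** Several obstacles lie below the Green identity. The space D[S1] is never built as a Hilbert
    space: with A the square root of S1, the map u -> A u + i u carries its inner product
    isometrically onto that of H, so orthogonal complements in D[S1] become projections in H.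
    Adjoints are produced by explicit formulas, and boundedness is then read off from them; even
    [gam] is bounded because its Gram operator is -M(-1). The extremal property of (M(-t) h, h)
    controls quadratic forms only, while two of the three limits are strong; the inequality |M(-t)
    h|^2 <= -B (1 + t) (M(-t) h, h) bridges the gap. For the factorization, W has a kernel, so gam =
    W X0 does not give X0^* X0 at once. The relation X0^* X0 = -M(-1) / 2 is checked on vectors sent
    by X0 into the range of W, and extended by density of that range in the kernel of S^* + 1. The
    density rests on ker W = ran (1 + S), which is what the equality dom S1 & dom S0 = dom S
    provides. *)

Definition rnorm H (u : H) : R := complex.Re `|u|.

(** The order of [R[i]] is partial, so estimates are carried out on real parts in [R]; complex
    identities are recovered by letting a complex scalar vary. *)
Definition rinner H (u v : H) : R := complex.Re (inner H u v).

Lemma ReD a b : complex.Re (a + b) = complex.Re a + complex.Re b.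
Proof. by case: a; case: b. Qed.

Lemma ReN a : complex.Re (- a) = - complex.Re a.
Proof. by case: a. Qed.

Lemma ReZ t a : complex.Re (t%:C * a) = t * complex.Re a.
Proof. by case: a => x y /=; rewrite mul0r subr0. Qed.

Lemma Re_conj a : complex.Re (Num.conj a) = complex.Re a.
Proof. by case: a. Qed.

Lemma Im_eq0_conj a : a = Num.conj a -> complex.Im a = 0.
Proof.
case: a => x y [] /eqP; rewrite -subr_eq0 opprK -mulr2n mulrn_eq0 /=.
by move=> /eqP.
Qed.

Lemma conj_real t : Num.conj (t%:C : R[i]) = t%:C.
Proof. exact: conjc_real. Qed.

Lemma ReC t : complex.Re (t%:C : R[i]) = t.
Proof. by []. Qed.

Lemma normcRE a : `|a| = (normc a)%:C.
Proof. by []. Qed.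

Lemma normc_ge0 a : 0 <= normc a.
Proof. by rewrite -lecR -normcRE normr_ge0. Qed.

Lemma Re_le_normc a : complex.Re a <= normc a.
Proof.
by rewrite (le_trans (ler_norm _)) // -lecR -normcRE normc_ge_Re.
Qed.

Section Space.
Variable H : hilbertSpace R.
Implicit Types u v w : H.

Lemma innerDl u v w : inner H (u + v) w = inner H u w + inner H v w.
Proof. exact: linearDl. Qed.
Lemma innerDr w u v : inner H w (u + v) = inner H w u + inner H w v.
Proof. exact: linearDr. Qed.
Lemma innerZl a u w : inner H (a *: u) w = a * inner H u w.
Proof. exact: linearZl_LR. Qed.
Lemma innerZr a w u : inner H w (a *: u) = Num.conj a * inner H w u.
Proof. exact: linearZr_LR. Qed.
Lemma innerNl u w : inner H (- u) w = - inner H u w.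
Proof. exact: linearNl. Qed.
Lemma innerNr w u : inner H w (- u) = - inner H w u.
Proof. exact: linearNr. Qed.
Lemma innerBl u v w : inner H (u - v) w = inner H u w - inner H v w.
Proof. by rewrite innerDl innerNl. Qed.
Lemma innerBr w u v : inner H w (u - v) = inner H w u - inner H w v.
Proof. by rewrite innerDr innerNr. Qed.
Lemma inner0l w : inner H 0 w = 0.
Proof. exact: linear0l. Qed.
Lemma inner0r w : inner H w 0 = 0.
Proof. exact: linear0r. Qed.
Lemma innerC u v : inner H u v = Num.conj (inner H v u).
Proof. by rewrite (@hermC _ false Num.conj _ (inner H)) expr0 mul1r. Qed.

Lemma rnormE u : `|u| = (rnorm u)%:C.
Proof. by have := normr_ge0 u; rewrite /rnorm lecE => /andP[/eqP]; case: `|u| =>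
  x y /= ->. Qed.

Lemma rnorm_ge0 u : 0 <= rnorm u.
Proof. by rewrite -lecR -rnormE normr_ge0. Qed.

Lemma rnorm0 : rnorm (0 : H) = 0.
Proof. by rewrite /rnorm normr0. Qed.

Lemma rnorm_eq0 u : rnorm u = 0 -> u = 0.
Proof. by move=> u0; apply/eqP; rewrite -normr_eq0 rnormE u0. Qed.

Lemma rnormD u v : rnorm (u + v) <= rnorm u + rnorm v.
Proof. by rewrite -lecR rmorphD /= -!rnormE ler_normD. Qed.

Lemma rnormN u : rnorm (- u) = rnorm u.
Proof. by rewrite /rnorm normrN. Qed.

Lemma rnormBC u v : rnorm (u - v) = rnorm (v - u).
Proof. by rewrite -rnormN opprB. Qed.

Lemma rnormZ a u : rnorm (a *: u) = normc a * rnorm u.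
Proof. by rewrite /rnorm normrZ normcRE ReZ. Qed.

Lemma rnormZr t u : rnorm (t%:C *: u) = `|t| * rnorm u.
Proof. by rewrite rnormZ /= expr0n /= addr0 sqrtr_sqr. Qed.

Lemma innerE u : inner H u u = ((rnorm u) ^+ 2)%:C.
Proof. by rewrite inner_norm rnormE -rmorphXn. Qed.

Lemma rinnerC u v : rinner u v = rinner v u.
Proof. by rewrite /rinner innerC Re_conj. Qed.
Lemma rinnerDl u v w : rinner (u + v) w = rinner u w + rinner v w.
Proof. by rewrite /rinner innerDl ReD. Qed.
Lemma rinnerNl u w : rinner (- u) w = - rinner u w.
Proof. by rewrite /rinner innerNl ReN. Qed.
Lemma rinnerBl u v w : rinner (u - v) w = rinner u w - rinner v w.
Proof. by rewrite rinnerDl rinnerNl. Qed.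
Lemma rinnerZl t u w : rinner (t%:C *: u) w = t * rinner u w.
Proof. by rewrite /rinner innerZl ReZ. Qed.
Lemma rinnerDr w u v : rinner w (u + v) = rinner w u + rinner w v.
Proof. by rewrite !(rinnerC w) rinnerDl. Qed.
Lemma rinnerNr w u : rinner w (- u) = - rinner w u.
Proof. by rewrite !(rinnerC w) rinnerNl. Qed.
Lemma rinnerBr w u v : rinner w (u - v) = rinner w u - rinner w v.
Proof. by rewrite !(rinnerC w) rinnerBl. Qed.
Lemma rinnerZr t w u : rinner w (t%:C *: u) = t * rinner w u.
Proof. by rewrite !(rinnerC w) rinnerZl. Qed.
Lemma rinner0l w : rinner 0 w = 0.
Proof. by rewrite /rinner inner0l. Qed.
Lemma rinner0r w : rinner w 0 = 0.
Proof. by rewrite rinnerC rinner0l. Qed.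

Lemma rinner_sq u : rinner u u = rnorm u ^+ 2.
Proof. by rewrite /rinner innerE. Qed.

Lemma rnormD2 u v : rnorm (u + v) ^+ 2 = rnorm u ^+ 2 + 2 * rinner u v + rnorm v ^+ 2.
Proof. by rewrite -!rinner_sq rinnerDl !rinnerDr (rinnerC v u); ring. Qed.

Lemma rnormB2 u v : rnorm (u - v) ^+ 2 = rnorm u ^+ 2 - 2 * rinner u v + rnorm v ^+ 2.
Proof. by rewrite rnormD2 rnormN rinnerNr mulrN. Qed.

Lemma rinner_le u v : rinner u v <= rnorm u * rnorm v.
Proof.
have [v0|] := eqVneq (rnorm v) 0.
  by rewrite (rnorm_eq0 v0) rinner0r rnorm0 mulr0.
have [u0|] := eqVneq (rnorm u) 0.
  by rewrite (rnorm_eq0 u0) rinner0l rnorm0 mul0r.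
rewrite !neq_lt !ltNge !rnorm_ge0 /= -!ltNge => u0 v0.
(* This square expands to 2 |u| |v| (|u| |v| - Re (u, v)). *)
have := sqr_ge0 (rnorm ((rnorm v)%:C *: u - (rnorm u)%:C *: v)).
rewrite rnormB2 rinnerZl rinnerZr !rnormZr !gtr0_norm //.
set r := rinner u v; set x := rnorm u; set y := rnorm v.
have -> : (y * x) ^+ 2 - 2 * (y * (x * r)) + (x * y) ^+ 2 = 2 * (x * y) * (x * y - r).
  by ring.
by rewrite pmulr_rge0 ?subr_ge0 // !mulr_gt0.
Qed.

Lemma rinner_le_abs u v : `|rinner u v| <= rnorm u * rnorm v.
Proof.
rewrite ler_norml rinner_le andbT lerNl -rinnerNl (le_trans (rinner_le _ _)) //.
by rewrite rnormN.
Qed.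

Lemma inner_eq0_rinner u v : (forall a, rinner (a *: u) v = 0) -> inner H u v = 0.
Proof.
move=> h; have := h 1; have := h 'i; rewrite /rinner !innerZl.
case: (inner H u v) => x y /=; rewrite !mul0r !mul1r sub0r subr0.
by move=> /eqP; rewrite oppr_eq0 => /eqP -> ->.
Qed.

Lemma rinner_eq0 u : (forall v, rinner u v = 0) -> u = 0.
Proof.
move=> /(_ u); rewrite rinner_sq => /eqP; rewrite sqrf_eq0 => /eqP.
exact: rnorm_eq0.
Qed.

Lemma inner_ext u v : (forall w, inner H u w = inner H v w) -> u = v.
Proof.
move=> uv; apply/eqP; rewrite -subr_eq0; apply/eqP/rinner_eq0 => w.
by rewrite /rinner innerBl uv subrr.
Qed.

Lemma rnorm_le_eps_eq0 u : (forall e : R, 0 < e -> rnorm u <= e) -> u = 0.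
Proof.
move=> h; apply: rnorm_eq0; apply/eqP; rewrite eq_le rnorm_ge0 andbT.
by apply/ler_addgt0Pr => e e0; rewrite add0r h.
Qed.

Definition rcvg (x : nat -> H) (l : H) : Prop :=
  forall e : R, 0 < e -> exists N, forall n, (N <= n)%N -> rnorm (x n - l) < e.

Lemma rcauchy_cvg (x : nat -> H) :
  (forall e : R, 0 < e -> exists N, forall m n, (N <= m)%N -> (N <= n)%N ->
     rnorm (x m - x n) < e) -> exists l, rcvg x l.
Proof.
move=> h.
have : cvg (x @ \oo).
  apply/cauchy_cvgP/cauchy_ballP => e e0.
  (* Radii of balls lie in [R[i]]; a positive one is real. *)
  have := e0; rewrite ltcE => /andP[/eqP /= ime ree].
  have [N hN] := h _ ree.
  exists (x @` [set n | (N <= n)%N], x @` [set n | (N <= n)%N]) => /=.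
    by split; exists N => //= n Nn; exists n.
  move=> [_ _] [/= [m Nm <-] [n Nn <-]].
  rewrite -ball_normE /= rnormE.
  have -> : e = (complex.Re e)%:C by move: ime; case: (e) => a b /= ->.
  by rewrite ltcR hN.
move=> /cvg_ex[l xl]; exists l => e e0.
have ec : (0 : R[i]) < e%:C by rewrite ltcR.
move/cvgrPdist_lt : xl => /(_ _ ec)[N _ hN]; exists N => n Nn.
by have := hN n Nn; rewrite rnormE ltcR rnormBC.
Qed.

End Space.
End HilbertBasics.

(** * Orthogonal projection along a subspace that need not be closed *)

Section Projection.
Variable R : realType.

Lemma invn_lt (e : R) : 0 < e ->
  exists N, forall n, (N <= n)%N -> n.+1%:R^-1 < e.
Proof.
move=> e0; exists (Num.truncn e^-1) => n Nn.
rewrite invf_plt ?posrE // (lt_le_trans (truncnS_gt _)) // ler_nat.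
by rewrite ltnS.
Qed.

Lemma sqr_lt_norm (x e : R) : 0 <= x -> 0 < e -> x ^+ 2 < e ^+ 2 -> x < e.
Proof. by move=> x0 e0; rewrite ltr_pXn2r // nnegrE ltW. Qed.

Variable H : hilbertSpace R.
Implicit Types (u v w : H) (V : set H).

Definition lin_subspace V : Prop :=
  V 0 /\ forall (a : R[i]) u v, V u -> V v -> V (a *: u + v).

Lemma lin_subspaceZ V a u : lin_subspace V -> V u -> V (a *: u).
Proof. by move=> [V0 VL] Vu; have := VL a u 0 Vu V0; rewrite addr0. Qed.

Lemma lin_subspaceD V u v : lin_subspace V -> V u -> V v -> V (u + v).
Proof. by move=> [V0 VL] Vu Vv; have := VL 1 u v Vu Vv; rewrite scale1r. Qed.

Lemma lin_subspaceN V u : lin_subspace V -> V u -> V (- u).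
Proof. by move=> sV Vu; rewrite -scaleN1r; apply: lin_subspaceZ. Qed.

Lemma lin_subspaceB V u v : lin_subspace V -> V u -> V v -> V (u - v).
Proof. by move=> sV Vu Vv; apply: lin_subspaceD => //; apply: lin_subspaceN. Qed.

Lemma inner_eq0_rinnerr u v :
  (forall a : R[i], rinner u (a *: v) = 0) -> inner H u v = 0.
Proof.
move=> h; rewrite innerC (_ : inner H v u = 0) ?rmorph0 //.
by apply: inner_eq0_rinner => a; rewrite rinnerC.
Qed.

(** Since [V] need not be closed, [x - q] is only a limit of elements of [V]. It is the limit of a
    minimizing sequence for the distance, Cauchy by the parallelogram law; the orthogonality of [q]
    is the first-order condition at the minimum. *)
Lemma projection V x : lin_subspace V -> exists q,
  (forall v, V v -> inner H q v = 0) /\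
  forall e : R, 0 < e -> exists2 v, V v & rnorm (x - q - v) < e.
Proof.
move=> sV; pose E := [set rnorm (x - v) ^+ 2 | v in V]; pose d := inf E.
have E0 : E !=set0 by exists (rnorm (x - 0) ^+ 2); exists 0 => //; case: sV.
have lbE : lbound E 0 by move=> _ [v _ <-]; rewrite sqr_ge0.
have dle v : V v -> d <= rnorm (x - v) ^+ 2.
  by move=> Vv; apply: ge_inf; [exists 0 | exists v].
have /choice[y yP] : forall n : nat, exists v, V v /\ rnorm (x - v) ^+ 2 < d + n.+1%:R^-1.
  move=> n; have n0 : 0 < n.+1%:R^-1 :> R by rewrite invr_gt0 ltr0n.
  have [_ [v Vv <-] lt] := inf_adherent n0 (conj E0 (ex_intro _ _ lbE)).
  by exists v.
have [p yp] : exists l, rcvg y l.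
  apply: rcauchy_cvg => e e0.
  (* The parallelogram law doubles each of the two excesses over [d], so excesses below e^2 / 4 give
     a squared distance below e^2. *)
  have [|N hN] := @invn_lt (e ^+ 2 / 4); first by rewrite divr_gt0 ?exprn_gt0.
  exists N => m n Nm Nn; apply: sqr_lt_norm => //; first exact: rnorm_ge0.
  have [[Vm lm] [Vn ln]] := (yP m, yP n).
  have h1 : rnorm (y m - y n) ^+ 2 =
    2 * rnorm (x - y m) ^+ 2 + 2 * rnorm (x - y n) ^+ 2
    - rnorm ((x - y m) + (x - y n)) ^+ 2.
    rewrite (rnormBC (y m)) (_ : y n - y m = (x - y m) - (x - y n)); last first.
      by rewrite opprB [RHS]addrC addrA subrK.
    by move: (x - y m) (x - y n) => a b; rewrite rnormB2 rnormD2; ring.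
  have h2 : 4 * d <= rnorm ((x - y m) + (x - y n)) ^+ 2.
    have -> : (x - y m) + (x - y n) =
        (2%:R : R)%:C *: (x - (2^-1 : R)%:C *: (y m + y n)).
      rewrite scalerBr scalerA -rmorphM divff ?pnatr_eq0 // scale1r.
      by rewrite rmorph_nat scaler_nat mulr2n opprD addrACA.
    rewrite rnormZr exprMn real_normK ?num_real // -natrX ler_pM2l ?ltr0n //.
    apply: dle; apply: lin_subspaceZ => //; exact: lin_subspaceD.
  have := hN m Nm; have := hN n Nn; move: lm ln h1 h2.
  move: (rnorm _ ^+ 2) (rnorm _ ^+ 2) (rnorm _ ^+ 2) (rnorm _ ^+ 2) => a b c f.
  by move: (_^-1) (_^-1) (e ^+ 2) => i j k; lra.
exists (x - p); split; last first.
  move=> e e0; have [N hN] := yp e e0; exists (y N); first by case: (yP N).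
  by rewrite subKr rnormBC hN.
move=> v0 Vv0; apply: inner_eq0_rinnerr => a.
move: (lin_subspaceZ a sV Vv0); move: (a *: v0) => v Vv; set r := rinner _ _.
(* Moving the minimizer by [s *: v] cannot decrease the distance; this is tested on [y n], up to an
   error [e]. *)
have key s : 2 * s * r <= s ^+ 2 * rnorm v ^+ 2.
  apply/ler_addgt0Pr => e e0.
  pose k : R := 2 * (1 + 2 * `|s| * rnorm v); have k0 : 0 < k.
    by rewrite mulr_gt0 // ltr_pwDl // !mulr_ge0 ?rnorm_ge0.
  have [N1 h1] := @yp (e / k) (divr_gt0 e0 k0).
  have [N2 h2] := @invn_lt (e / 2) (divr_gt0 e0 (ltr0n _ 2)).
  pose n := maxn N1 N2; have {}h1 := h1 n (leq_maxl _ _).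
  have {}h2 := h2 n (leq_maxr _ _); have [Vn ln] := yP n.
  have := dle _ (lin_subspaceD sV Vn (lin_subspaceZ s%:C sV Vv)).
  rewrite opprD addrA rnormB2 rinnerZr rnormZr exprMn real_normK ?num_real // => h3.
  have -> : r = rinner (x - y n) v + rinner (y n - p) v.
    by rewrite -rinnerDl addrA subrK.
  have h4 : 2 * s * rinner (y n - p) v <= e / 2.
    rewrite (le_trans (ler_norm _)) // 2!normrM (ger0_norm (ler0n _ 2)).
    rewrite (@le_trans _ _ (2 * `|s| * (e / k * rnorm v))) //.
      rewrite ler_wpM2l ?mulr_ge0 // (le_trans (rinner_le_abs _ _)) //.
      by rewrite ler_wpM2r ?rnorm_ge0 // ltW.
    rewrite (_ : 2 * `|s| * (e / k * rnorm v) = e / k * (2 * `|s| * rnorm v)); last ring.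
    rewrite (@le_trans _ _ (e / k * (k / 2))) //.
      rewrite ler_wpM2l ?divr_ge0 // ?ltW //.
      by rewrite /k; lra.
    by rewrite mulrA divfK ?gt_eqF.
  move: h2 ln h3 h4; move: (n.+1%:R^-1) => i.
  by rewrite mulrDr; move: (rinner _ _) (rinner _ _) => r1 r2; lra.
(* The optimal s would be r / |v|^2; adding 1 covers v = 0 and still forces r^2 <= 0. *)
have := key (r / (rnorm v ^+ 2 + 1)); have v1 : 0 < rnorm v ^+ 2 + 1.
  by rewrite ltr_wpDl ?sqr_ge0.
rewrite expr_div_n => h.
have : 2 * (r ^+ 2 / (rnorm v ^+ 2 + 1)) <= r ^+ 2 / (rnorm v ^+ 2 + 1).
  rewrite (_ : 2 * (r ^+ 2 / _) = 2 * (r / (rnorm v ^+ 2 + 1)) * r); last ring.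
  rewrite (le_trans h) //; set X := _ + 1.
  rewrite (_ : r ^+ 2 / X ^+ 2 * _ = r ^+ 2 / X * (rnorm v ^+ 2 / X)).
    have X0 : 0 <= X by rewrite ltW.
    by rewrite ler_piMr ?divr_ge0 ?sqr_ge0 // ler_pdivrMr // mul1r lerDl.
  by rewrite expr2 invfM; ring.
rewrite -subr_ge0 (_ : _ - _ = - (r ^+ 2 / (rnorm v ^+ 2 + 1))); last ring.
rewrite oppr_ge0 pmulr_lle0 ?invr_gt0 // => r2.
by apply/eqP; rewrite -sqrf_eq0 eq_le r2 sqr_ge0.
Qed.

End Projection.

(** * Consequences of completeness: automatic boundedness and closed ranges *)

Section Completeness.
Variable R : realType.

Lemma le0_eps (x C : R) : (forall e : R, 0 < e -> x <= C * e) -> x <= 0.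
Proof.
move=> h; rewrite leNgt; apply/negP => x0.
have [C0|C0] := leP C 0.
  by have := h 1 ltr01; rewrite mulr1 leNgt (le_lt_trans C0).
have := h (x / (2 * C)) (divr_gt0 x0 (mulr_gt0 (ltr0n _ 2) C0)).
have -> : C * (x / (2 * C)) = x / 2 by field; rewrite gt_eqF.
by rewrite ler_pdivlMr // mulr_natr mulr2n gerDl leNgt x0.
Qed.

Lemma complex_eq0 (D : R[i]) : (forall a : R[i], complex.Re (a * D) <= 0) -> D = 0.
Proof.
move=> h; have := h 1; have := h (-1); have := h 'i; have := h (-'i).
by case: D {h} => x y /= *; congr (_ +i* _); lra.
Qed.

(** The increments of [s] dominate norms, so [s] is nondecreasing and, being bounded, controls the
    tails of [x]. This serves a geometric series as well as the square root iteration, whose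
    majorant comes without a rate. *)
Lemma dominated_steps_cvg (H : hilbertSpace R) (x : nat -> H) (s : nat -> R) (b : R) :
  (forall n, s n <= b) -> (forall n, rnorm (x n.+1 - x n) <= s n.+1 - s n) ->
  exists l, rcvg x l /\ forall n, rnorm (l - x n) <= b - s n.
Proof.
move=> sb xs.
have xk n k : rnorm (x (n + k)%N - x n) <= s (n + k)%N - s n.
  elim: k => [|k ih]; first by rewrite addn0 !subrr rnorm0.
  rewrite addnS -(subrKA (x (n + k)%N)) -[leRHS](subrKA (s (n + k)%N)).
  by rewrite (le_trans (rnormD _ _)) // lerD.
have [l xl] : exists l, rcvg x l.
  apply: rcauchy_cvg => e e0; pose E := range s.
  have E0 : E !=set0 by exists (s 0%N); exists 0%N.
  have ubE : ubound E b by move=> _ [n _ <-].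
  have hsE : has_sup E by split => //; exists b.
  have e2 : 0 < e / 2 by rewrite divr_gt0.
  have [_ [N _ <-] Ns] := sup_adherent e2 hsE.
  have key n : (N <= n)%N -> rnorm (x n - x N) < e / 2.
    move=> /subnKC <-; apply: le_lt_trans (xk _ _) _.
    have : s (N + (n - N))%N <= sup E by apply: ub_le_sup; [exists b | exists (N + (n - N))%N].
    by move: (s _) (s _) (sup E) Ns => a c d; lra.
  exists N => m n Nm Nn; rewrite -(subrKA (x N)) (le_lt_trans (rnormD _ _)) //.
  by rewrite (rnormBC (x N)); have := key _ Nm; have := key _ Nn; lra.
exists l; split => // n; rewrite -subr_le0; apply: (@le0_eps _ 1) => e e0.
have [N hN] := xl e e0.
have h1 : rnorm (l - x (n + N)%N) < e by rewrite rnormBC hN ?leq_addl.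
have := xk n N; have := sb (n + N)%N.
have := rnormD (l - x (n + N)%N) (x (n + N)%N - x n); rewrite subrKA mul1r.
by move: (rnorm _) (rnorm _) (rnorm _) h1 (s _) (s _) => a c d ? i j; lra.
Qed.

(** Both sides have the same inner products with every vector, because (x, B y) is linear in x. *)
Lemma adjoint_pair_linear (H V : hilbertSpace R) (A : H -> V) (B : V -> H) :
  (forall x y, inner V (A x) y = inner H x (B y)) -> linear A.
Proof.
move=> AB a x y; apply: inner_ext => w.
by rewrite AB innerDl innerZl innerDl innerZl !AB.
Qed.

(* The Hellinger-Toeplitz theorem, by a gliding hump: if [A] were unbounded, one
   could pick [x n] with [rnorm (A (x n)) > (n+1) 3^n rnorm (x n)] and sum
   [+- 3^-n A (x n) / rnorm (A (x n))] to a vector at which [B] is infinite. *)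
Lemma adjoint_pair_bounded (H V : hilbertSpace R) (A : H -> V) (B : V -> H) :
  (forall x y, inner V (A x) y = inner H x (B y)) ->
  exists2 C, 0 <= C & forall x, rnorm (A x) <= C * rnorm x.
Proof.
move=> AB; apply: contrapT => nb.
pose t n : R := 3^-1 ^+ n; have t0 n : 0 < t n by rewrite exprn_gt0 // invr_gt0.
have /choice[x xP] (n : nat) : exists x, n.+1%:R * rnorm x < t n * rnorm (A x).
  apply: contrapT => h; apply: nb; exists (n.+1%:R / t n).
    by rewrite divr_ge0 // ltW.
  move=> x; rewrite mulrAC ler_pdivlMr // mulrC leNgt; apply/negP => xh.
  by apply: h; exists x.
pose a n := rnorm (A (x n)).
have a0 n : 0 < a n.
  rewrite -(pmulr_rgt0 _ (t0 n)); apply: le_lt_trans (xP n).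
  by rewrite mulr_ge0 ?rnorm_ge0.
pose w n := (a n)^-1%:C *: A (x n).
have w1 n : rnorm (w n) = 1.
  by rewrite /w rnormZr gtr0_norm ?invr_gt0 // mulVf ?gt_eqF.
(* The sign keeps the new term from cancelling the component of [y] along [w n]. *)
pose step n y := if 0 <= rinner y (w n) then (t n)%:C *: w n else - ((t n)%:C *: w n).
pose y := fix F n := if n is k.+1 then F k + step k (F k) else (0 : V).
have ystep n : rnorm (y n.+1 - y n) <= - (3 / 2) * t n.+1 - - (3 / 2) * t n.
  rewrite /= addrC addKr /step.
  have -> : - (3 / 2) * t n.+1 - - (3 / 2) * t n = t n by rewrite /t exprS; field.
  by case: ifP => _; rewrite ?rnormN rnormZr w1 mulr1 gtr0_norm.
have yw n : t n <= `|rinner (y n.+1) (w n)|.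
  rewrite /= rinnerDl /step; case: ifP => h;
    rewrite ?rinnerNl rinnerZl rinner_sq w1 expr1n mulr1.
    by rewrite ger0_norm ?addr_ge0 ?lerDr // ltW.
  move/negbT: h; rewrite -ltNge => h; rewrite ltr0_norm ?opprD ?opprK ?lerDr ?oppr_ge0 ?ltW //.
  by rewrite -oppr_gt0 opprD opprK addr_gt0 ?oppr_gt0.
(* The sum of 3^-k over k >= n is (3/2) 3^-n. After step n the remaining tail is therefore half of
   that step, and half of the component along [w n] survives in the limit. *)
have [|l [_ yl]] := @dominated_steps_cvg _ y (fun n => - (3 / 2) * t n) 0 _ ystep.
  by move=> n; rewrite mulNr oppr_le0 mulr_ge0 ?ltW.
have wl n : t n / 2 <= `|rinner l (w n)|.
  have tS : t n.+1 = t n / 3 by rewrite /t exprS mulrC.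
  have := le_trans (rinner_le_abs (l - y n.+1) (w n)) _.
  rewrite w1 mulr1 => /(_ _ (yl n.+1)); rewrite rinnerBl distrC => h.
  have := ler_normD (rinner l (w n)) (rinner (y n.+1) (w n) - rinner l (w n)).
  rewrite [in X in X -> _]addrC subrK.
  by move: h (yw n); rewrite tS; lra.
pose n := Num.truncn (2 * rnorm (B l)).
have : n.+1%:R <= 2 * rnorm (B l).
  have h1 : a n * (t n / 2) <= rnorm (x n) * rnorm (B l).
    rewrite (le_trans _ (rinner_le_abs _ _)) // /rinner -AB -/(rinner _ _) rinnerC.
    have -> : A (x n) = (a n)%:C *: w n.
      by rewrite /w scalerA -rmorphM divff ?gt_eqF // scale1r.
    by rewrite rinnerZr normrM gtr0_norm // ler_wpM2l // ltW.
  rewrite -(@ler_pM2l _ (a n * t n / 2)) ?divr_gt0 ?mulr_gt0 //.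
  apply: le_trans (_ : n.+1%:R * rnorm (x n) * rnorm (B l) <= _).
    by rewrite -(mulrA (a n)) mulrC -mulrA ler_wpM2l.
  apply: le_trans (ler_wpM2r (rnorm_ge0 _) (ltW (xP n))) _.
  by rewrite /a le_eqVlt; apply/orP; left; apply/eqP; field.
by rewrite leNgt truncnS_gt.
Qed.

Lemma rinner_le_normc (H : hilbertSpace R) (u v : H) (z : R[i]) :
  complex.Re (z * inner H u v) <= normc z * rnorm u * rnorm v.
Proof. by rewrite -innerZl -/(rinner _ _) -rnormZ rinner_le. Qed.

Lemma inner_continuous2 (U V : hilbertSpace R) (x u : U) (y v : V)
    (xn : nat -> U) (yn : nat -> V) :
  rcvg xn x -> rcvg yn y ->
  (forall n, inner U (xn n) u = inner V (yn n) v) -> inner U x u = inner V y v.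
Proof.
move=> xc yc h; apply/eqP; rewrite -subr_eq0; apply/eqP.
apply: complex_eq0 => a; apply: (@le0_eps _ (normc a * rnorm u + normc a * rnorm v)) => e e0.
have [N1 h1] := xc e e0; have [N2 h2] := yc e e0.
pose n := maxn N1 N2; have {}h1 := h1 n (leq_maxl _ _).
have {}h2 := h2 n (leq_maxr _ _).
have -> : inner U x u - inner V y v = inner U (x - xn n) u + inner V (yn n - y) v.
  by rewrite !innerBl h addrA subrK.
rewrite mulrDr ReD mulrDl lerD // (le_trans (rinner_le_normc _ _ _)) //.
  by rewrite mulrAC ler_wpM2l ?mulr_ge0 ?normc_ge0 ?rnorm_ge0 // rnormBC ltW.
by rewrite mulrAC ler_wpM2l ?mulr_ge0 ?normc_ge0 ?rnorm_ge0 // ltW.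
Qed.

Lemma adjoint_closed (U V : hilbertSpace R) (T : oper V U) un vn u v :
  (forall n, adjoint T (un n, vn n)) -> rcvg un u -> rcvg vn v -> adjoint T (u, v).
Proof.
move=> h uc vc x y /= Txy; rewrite innerC [RHS]innerC; congr Num.conj.
by apply: inner_continuous2 uc vc _ => n; rewrite innerC (h n x y Txy) -innerC.
Qed.

Lemma rcvg_ext (H : hilbertSpace R) (x : nat -> H) l :
  (forall n, rnorm (l - x n) < n.+1%:R^-1) -> rcvg x l.
Proof.
move=> h e e0; have [N hN] := invn_lt e0; exists N => n /hN.
by rewrite rnormBC; apply: lt_trans.
Qed.

Lemma linear_operB (U V : hilbertSpace R) (T : oper U V) u v u' v' :
  linear_oper T -> T (u, v) -> T (u', v') -> T (u - u', v - v').
Proof.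
move=> [T0 TL _] h h'; have := TL (-1) u' v' u v h' h.
by rewrite !scaleN1r ![- _ + _]addrC.
Qed.

(** An adjoint is closed, and the lower bound turns convergence of values into convergence of
    preimages, so the range is closed; it is dense because the adjoint of [T] has trivial kernel. *)
Lemma closed_range_onto (U V : hilbertSpace R) (T : oper U V) (T' : oper V U) c :
  linear_oper T -> T = adjoint T' ->
  (forall q, adjoint T (q, 0) -> q = 0) ->
  0 < c -> (forall u v, T (u, v) -> c * rnorm u <= rnorm v) ->
  forall f, exists u, T (u, f).
Proof.
move=> linT TE ker0 c0 low f.
have sR : lin_subspace (oper_ran T).
  have [T0 TL _] := linT; split; first by exists 0.
  by move=> a v v' [u Tu] [u' Tu']; exists (a *: u + u'); apply: TL.
have [q [qV qf]] := projection f sR.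
have q0 : q = 0.
  apply: ker0 => u v /= Tuv; rewrite inner0r innerC qV ?rmorph0 //.
  by exists u.
have /choice[p pP] : forall n : nat, exists p : U * V,
    T p /\ rnorm (f - p.2) < n.+1%:R^-1.
  move=> n; have n0 : 0 < n.+1%:R^-1 :> R by rewrite invr_gt0 ltr0n.
  have [v [u Tuv] lt] := qf _ n0; exists (u, v); split => //.
  by rewrite q0 subr0 in lt.
have vc : rcvg (fun n => (p n).2) f by apply: rcvg_ext => n; case: (pP n).
have Tp n : T ((p n).1, (p n).2) by rewrite -surjective_pairing; case: (pP n).
have [u uc] : exists l, rcvg (fun n => (p n).1) l.
  apply: rcauchy_cvg => e e0.
  have [|N hN] := vc (c * e / 2); first by rewrite divr_gt0 ?mulr_gt0.
  exists N => m n Nm Nn.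
  rewrite -(ltr_pM2l c0) (le_lt_trans (low _ _ (linear_operB linT (Tp m) (Tp n)))) //.
  rewrite -(subrKA f) (le_lt_trans (rnormD _ _)) // (rnormBC f).
  by have := hN _ Nm; have := hN _ Nn; lra.
by exists u; rewrite TE; apply: adjoint_closed uc vc => n; rewrite -TE.
Qed.

End Completeness.

(** * Square roots of nonnegative operators *)

Section BoundedOperators.
Variables (R : realType) (H : hilbertSpace R).
Implicit Types (f g : H -> H) (x y : H).

Definition symmetric_fun f : Prop :=
  forall x y, inner H (f x) y = inner H x (f y).

Definition norm_bounded (U V : hilbertSpace R) (f : U -> V) : Prop :=
  exists2 c : R, 0 <= c & forall x : U, rnorm (f x) <= c * rnorm x.

Lemma rcvg_unique (x : nat -> H) l l' : rcvg x l -> rcvg x l' -> l = l'.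
Proof.
move=> xl xl'; apply/eqP; rewrite -subr_eq0; apply/eqP; apply: rnorm_eq0.
apply/eqP; rewrite eq_le rnorm_ge0 andbT; apply: (@le0_eps _ _ 2) => e e0.
have [N1 h1] := xl e e0; have [N2 h2] := xl' e e0; pose n := maxn N1 N2.
rewrite -(subrKA (x n)) (le_trans (rnormD _ _)) // (rnormBC l).
have := h1 n (leq_maxl _ _); have := h2 n (leq_maxr _ _); lra.
Qed.

Lemma rcvg_dist (x y : nat -> H) l (C : R) : 0 <= C ->
  (forall e : R, 0 < e -> exists N, forall n, (N <= n)%N -> rnorm (y n - l) <= C * e) ->
  rcvg y l.
Proof.
move=> C0 h e e0; have C1 : 0 < C + 1 by rewrite ltr_wpDl.
have [N hN] := h _ (divr_gt0 e0 C1); exists N => n /hN /le_lt_trans; apply.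
by rewrite mulrA ltr_pdivrMr // mulrC ltr_pM2l // ltrDl.
Qed.

Lemma symmetric_fun_linear f : symmetric_fun f -> linear f.
Proof. exact: adjoint_pair_linear. Qed.

Lemma linear_funB (U V : hilbertSpace R) (f : U -> V) (x y : U) :
  linear f -> f (x - y) = f x - f y.
Proof. by move=> lf; have := lf (-1) y x; rewrite !scaleN1r ![- _ + _]addrC. Qed.

Lemma linear_funD (U V : hilbertSpace R) (f : U -> V) (x y : U) :
  linear f -> f (x + y) = f x + f y.
Proof. by move=> lf; have := lf 1 x y; rewrite !scale1r. Qed.

Lemma linear_fun0 (U V : hilbertSpace R) (f : U -> V) : linear f -> f 0 = 0.
Proof. by move=> lf; have := linear_funB 0 0 lf; rewrite !subrr. Qed.

Lemma linear_funZ (U V : hilbertSpace R) (f : U -> V) (a : R[i]) (x : U) :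
  linear f -> f (a *: x) = a *: f x.
Proof. by move=> lf; rewrite -[a *: x]addr0 lf linear_fun0 // addr0. Qed.

Lemma rcvg_map (V : hilbertSpace R) (f : H -> V) (x : nat -> H) l :
  linear f -> norm_bounded f -> rcvg x l -> rcvg (fun n => f (x n)) (f l).
Proof.
move=> lf [c c0 fc] xl e e0; have c1 : 0 < c + 1 by rewrite ltr_wpDl.
have [N hN] := xl _ (divr_gt0 e0 c1); exists N => n /hN.
rewrite ltr_pdivlMr // => h.
rewrite -linear_funB //.
rewrite (le_lt_trans (fc _)) // (le_lt_trans _ h) // mulrC.
by rewrite ler_wpM2l ?rnorm_ge0 // lerDl.
Qed.

Lemma symmetric_cvg (x y : nat -> H) l k u v :
  rcvg x l -> rcvg y k -> (forall n, inner H (x n) u = inner H v (y n)) ->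
  inner H l u = inner H v k.
Proof.
move=> xc yc h; apply/eqP; rewrite -subr_eq0; apply/eqP.
apply: complex_eq0 => a; apply: (@le0_eps _ _ (normc a * rnorm u + normc a * rnorm v)) => e e0.
have [N1 h1] := xc e e0; have [N2 h2] := yc e e0.
pose n := maxn N1 N2; have {}h1 := h1 n (leq_maxl _ _).
have {}h2 := h2 n (leq_maxr _ _).
have -> : inner H l u - inner H v k = inner H (l - x n) u + inner H v (y n - k).
  by rewrite innerBl innerBr h addrA subrK.
rewrite mulrDr ReD mulrDl lerD // (le_trans (rinner_le_normc _ _ _)) //.
  by rewrite mulrAC ler_wpM2l ?mulr_ge0 ?normc_ge0 ?rnorm_ge0 // rnormBC ltW.
by rewrite ler_wpM2l ?mulr_ge0 ?normc_ge0 ?rnorm_ge0 // ltW.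
Qed.

(* Polarization: [4 rinner (f x) y] is [rinner (f (x + y)) (x + y)] minus
   [rinner (f (x - y)) (x - y)]; take [y := f x]. *)
Lemma numerical_radius_le1 f : symmetric_fun f ->
  (forall x, `|rinner (f x) x| <= rnorm x ^+ 2) -> forall x, rnorm (f x) <= rnorm x.
Proof.
move=> sf h x; have lf := symmetric_fun_linear sf; set y := f x.
have := h (x + y); have := h (x - y).
rewrite !rnormD2 rnormN rinnerNr linear_funB // linear_funD //.
rewrite rinnerBl !rinnerBr rinnerDl !rinnerDr.
have -> : rinner (f y) x = rinner y y by rewrite /rinner sf.
rewrite -/y rinner_sq => h1 h2; have := ler_norm (rinner y x + rnorm y ^+ 2 + (rnorm y ^+ 2 + rinner (f y) y)).
have := ler_norm (- (rinner y x - rnorm y ^+ 2 - (rnorm y ^+ 2 - rinner (f y) y))).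
rewrite normrN => h3 h4.
have : rnorm y ^+ 2 <= rnorm x ^+ 2 by move: (rnorm _ ^+ 2) (rnorm _ ^+ 2) h1 h2 h3 h4 => p q; lra.
by rewrite ler_pXn2r // nnegrE rnorm_ge0.
Qed.

Section SquareRoot.
Variable C : H -> H.
Hypothesis symC : symmetric_fun C.
Hypothesis C01 : forall x, 0 <= rinner (C x) x <= rnorm x ^+ 2.

Let D x := x - C x.

Let symD : symmetric_fun D.
Proof. by move=> x y; rewrite /D innerBl innerBr symC. Qed.

Let D1 x : rnorm (D x) <= rnorm x.
Proof.
apply: (numerical_radius_le1 symD) => {}x; rewrite /D rinnerBl rinner_sq.
by have /andP[h1 h2] := C01 x; rewrite ger0_norm ?subr_ge0 // gerBl.
Qed.

Let half : R[i] := (2^-1 : R)%:C.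

(* The square root of [C = 1 - D] is [1 - Y], where [Y = (D + Y^2) / 2] is
   obtained by iteration; [s] is the same iteration for [D = 1]. *)
Fixpoint sqrt_iter n x : H :=
  if n is k.+1 then half *: (D x + sqrt_iter k (sqrt_iter k x)) else 0.

Fixpoint sqrt_bound n : R :=
  if n is k.+1 then (1 + sqrt_bound k ^+ 2) / 2 else 0.

Let Y := sqrt_iter.
Let s := sqrt_bound.

Let s01 n : 0 <= s n <= 1.
Proof.
elim: n => [|n /andP[h1 h2]]; first by rewrite lexx ler01.
rewrite /s /= -/(s n) divr_ge0 ?addr_ge0 ?sqr_ge0 //= ler_pdivrMr // mul1r.
have : s n ^+ 2 <= 1 by rewrite expr_le1.
by move: (s n ^+ 2) => q; lra.
Qed.

Let rnorm_half x : rnorm (half *: x) = rnorm x / 2.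
Proof. by rewrite /half rnormZr ger0_norm ?invr_ge0 // mulrC. Qed.

Let symY n : symmetric_fun (Y n).
Proof.
elim: n => [|n ih] x y; first by rewrite /Y /= inner0l inner0r.
rewrite /Y /= -/(Y n) innerZl innerZr innerDl innerDr symD !ih.
by rewrite conj_real.
Qed.

Let linY n : linear (Y n).
Proof. exact: symmetric_fun_linear. Qed.

Let Yle n x : rnorm (Y n x) <= s n * rnorm x.
Proof.
elim: n x => [|n ih] x; first by rewrite /Y /= rnorm0 mul0r.
rewrite /Y /s /= -/(Y n) -/(s n) rnorm_half mulrAC ler_pM2r ?invr_gt0 //.
rewrite (le_trans (rnormD _ _)) // mulrDl mul1r lerD //.
rewrite (le_trans (ih _)) // expr2 -mulrA ler_wpM2l //.
by case/andP: (s01 n).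
Qed.

(** Half of the difference of squares Y'^2 - Y^2 = Y' (Y' - Y) + (Y' - Y) Y, an identity that does
    not require Y' and Y to commute. Each factor is dominated by its scalar counterpart, and the
    scalar bounds recombine to s'^2 - s^2. *)
Let Ydiff n x : rnorm (Y n.+1 x - Y n x) <= (s n.+1 - s n) * rnorm x.
Proof.
elim: n x => [|n ih] x.
  have -> : Y 1 x - Y 0 x = half *: D x by rewrite /Y /= subr0 addr0.
  have -> : s 1 - s 0 = 1 / 2 by rewrite /s /= expr0n addr0 subr0.
  by rewrite rnorm_half mulrAC mul1r ler_pM2r ?invr_gt0.
have -> : Y n.+2 x - Y n.+1 x =
    half *: (Y n.+1 (Y n.+1 x - Y n x) + (Y n.+1 (Y n x) - Y n (Y n x))).
  rewrite (linear_funB _ _ (linY n.+1)) subrKA.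
  have YS k : Y k.+1 x = half *: (D x + Y k (Y k x)) by [].
  by rewrite {1}YS {2}YS -scalerBr opprD addrACA subrr add0r.
rewrite rnorm_half ler_pdivrMr //.
have [/andP[s0 _] /andP[s0' _]] := (s01 n.+1, s01 n).
have h1 := le_trans (Yle n.+1 (Y n.+1 x - Y n x)) (ler_wpM2l s0 (ih x)).
have d0 : 0 <= s n.+1 - s n.
  rewrite /s /= -/(s n); have := sqr_ge0 (s n - 1); rewrite sqrrB1; lra.
have h2 := le_trans (ih (Y n x)) (ler_wpM2l d0 (Yle n x)).
have := rnormD (Y n.+1 (Y n.+1 x - Y n x)) (Y n.+1 (Y n x) - Y n (Y n x)).
have e : (s n.+2 - s n.+1) * 2 = s n.+1 ^+ 2 - s n ^+ 2.
  have -> : s n.+2 = (1 + s n.+1 ^+ 2) / 2 by [].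
  by rewrite [X in _ - X](_ : _ = (1 + s n ^+ 2) / 2) //; field.
rewrite mulrAC e => /le_trans; apply; apply: le_trans (lerD h1 h2) _.
by rewrite le_eqVlt; apply/orP; left; apply/eqP; ring.
Qed.

(** The iterates are polynomials in [D], so whatever commutes with [C] commutes with them and with
    their limit. The last clause is what makes the roots of (1 + T)^-1 and of 1 - (1 + T)^-1 commute
    in [nonneg_sqrt]. *)
Lemma bounded_sqrt : exists P : H -> H,
  [/\ symmetric_fun P, forall x, 0 <= rinner (P x) x <= rnorm x ^+ 2,
      forall x, P (P x) = C x
    & forall f, linear f -> norm_bounded f -> (forall x, f (C x) = C (f x)) ->
      forall x, f (P x) = P (f x)].
Proof.
have [L LP] : exists L : H -> H, forall x, rcvg (Y ^~ x) (L x).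
  suff /choice[L LP] : forall x, exists l, rcvg (Y ^~ x) l by exists L.
  move=> x; have [|n|l [xl _]] := @dominated_steps_cvg _ H (Y ^~ x) (fun n =>
    s n * rnorm x) (rnorm x).
  - by move=> n; rewrite ler_piMl ?rnorm_ge0 //; case/andP: (s01 n).
  - by rewrite -mulrBl Ydiff.
  - by exists l.
have Y1 n x : rnorm (Y n x) <= rnorm x.
  by rewrite (le_trans (Yle _ _)) // ler_piMl ?rnorm_ge0 //; case/andP: (s01 n).
have symL : symmetric_fun L.
  by move=> x y; apply: symmetric_cvg (LP x) (LP y) _ => n; rewrite symY.
have linL := symmetric_fun_linear symL.
have L1 x : rnorm (L x) <= rnorm x.
  rewrite -subr_le0; apply: (@le0_eps _ _ 1) => e e0.
  have [N /(_ N (leqnn N)) h] := LP x e e0.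
  have := rnormD (L x - Y N x) (Y N x); rewrite subrK rnormBC.
  by have := Y1 N x; lra.
have YY x : rcvg (fun n => Y n (Y n x)) (L (L x)).
  apply: (@rcvg_dist (fun=> 0) _ _ 2) => // e e0.
  have [N1 h1] := LP x e e0; have [N2 h2] := LP (L x) e e0.
  exists (maxn N1 N2) => n; rewrite geq_max => /andP[/h1 {}h1 /h2 {}h2].
  rewrite -(subrKA (Y n (L x))) -linear_funB // (le_trans (rnormD _ _)) //.
  by have := Y1 n (Y n x - L x); lra.
have LE x : L x = half *: (D x + L (L x)).
  apply: (@rcvg_unique (fun n => Y n.+1 x)).
    by move=> e /(LP x)[N hN]; exists N => n Nn; apply: hN; rewrite leqW.
  move=> e e0; have [N hN] := YY x e e0; exists N => n /hN h.
  rewrite [Y n.+1 x]/(half *: (D x + Y n (Y n x))) -scalerBr rnorm_half.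
  rewrite opprD addrACA subrr add0r; move: h;
    have := rnorm_ge0 (Y n (Y n x) - L (L x)); lra.
have PP x : x - L x - L (x - L x) = C x.
  have -> : C x = x - D x by rewrite /D subKr.
  rewrite linear_funB //; have : half *: (D x + L (L x)) + half *: (D x + L (L x)) = D x + L (L x).
    rewrite -scalerDl (_ : half + half = 1) ?scale1r //.
    by rewrite /half -rmorphD -[2^-1]mul1r -splitr.
  rewrite -LE => /esym/(canRL (addrK _)) ->.
  by rewrite -addrA -opprD addrA.
exists (fun x => x - L x); split => //.
- by move=> x y; rewrite innerBl innerBr symL.
- move=> x; apply/andP; split.
    rewrite rinnerBl rinner_sq subr_ge0 (le_trans (rinner_le _ _)) //.
    by rewrite expr2 ler_wpM2r ?rnorm_ge0.
  rewrite (le_trans (rinner_le _ _)) // expr2 ler_wpM2r ?rnorm_ge0 //.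
  have symP : symmetric_fun (fun x => x - L x).
    by move=> y z; rewrite innerBl innerBr symL.
  rewrite -(@ler_pXn2r _ 2) // ?nnegrE ?rnorm_ge0 // -rinner_sq /rinner symP PP.
  by rewrite -/(rinner _ _) rinnerC; case/andP: (C01 x).
- move=> f lf bf fC x; rewrite linear_funB //; congr (_ - _).
  have fY n y : f (Y n y) = Y n (f y).
    elim: n y => [|n ih] y; first by rewrite /Y /= linear_fun0.
    rewrite /Y /= linear_funZ // linear_funD // -/(Y n) !ih /D linear_funB //.
    by rewrite fC.
  apply: (@rcvg_unique (fun n => Y n (f x))) => //.
  have := rcvg_map lf bf (LP x); congr (rcvg _ _).
  by apply/funext => n; rewrite fY.
Qed.

End SquareRoot.
End BoundedOperators.

(** * Resolvents and square roots of unbounded selfadjoint operators *)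

Section SelfadjointOperators.
Variables (R : realType) (H : hilbertSpace R).
Implicit Types (T A : oper H H) (z : R[i]) (u v w f x y : H).

Lemma dense_approx (D : set H) x (e : R) : dense D -> 0 < e ->
  exists2 u, D u & rnorm (x - u) < e.
Proof.
move=> dD e0; have ec : (0 : R[i]) < e%:C by rewrite ltcR.
have [||u [/= xu Du]] := dD (ball x e%:C).
- by exists x; apply: ballxx.
- exact: ball_open.
by exists u => //; move: xu; rewrite -ball_normE /= rnormE ltcR.
Qed.

Lemma dense_orthogonal0 (D : set H) x : dense D ->
  (forall u, D u -> inner H u x = 0) -> x = 0.
Proof.
move=> dD h; apply: rnorm_le_eps_eq0 => e e0.
have [u Du xu] := dense_approx x dD e0.
have : rnorm x ^+ 2 <= rnorm (x - u) * rnorm x.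
  rewrite (le_trans _ (rinner_le _ _)) // rinnerBl rinner_sq.
  by rewrite /rinner h //= subr0.
rewrite expr2; have [->|x0] := eqVneq (rnorm x) 0; first by move=> _; apply: ltW.
have {}x0 : 0 < rnorm x by rewrite lt_def x0 rnorm_ge0.
by rewrite ler_pM2r // => /le_trans; apply; apply: ltW.
Qed.

Lemma symmetricE T u v u' v' : selfadjoint T -> T (u, v) -> T (u', v') ->
  inner H v u' = inner H u v'.
Proof. by move=> [_ _ sT] Tuv; rewrite -{1}sT => /(_ _ _ Tuv). Qed.

Lemma selfadjointI T x y : selfadjoint T ->
  (forall u v, T (u, v) -> inner H v x = inner H u y) -> T (x, y).
Proof. by move=> [_ _ sT] h; rewrite -sT. Qed.

(** The adjoint of T - z is T - conj z. Hence the bound at z gives a closed range and the bound at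
    conj z gives a dense one. *)
Lemma selfadjoint_shift_onto T z (c : R) : selfadjoint T -> 0 < c ->
  (forall u v, T (u, v) -> c * rnorm u <= rnorm (v - z *: u)) ->
  (forall u v, T (u, v) -> c * rnorm u <= rnorm (v - Num.conj z *: u)) ->
  forall f, exists u, T (u, f + z *: u).
Proof.
move=> saT c0 low low' f; have [[T0 TL TF] dT sT] := saT.
pose shift a : oper H H := [set p | T (p.1, p.2 + a *: p.1)].
have adj a x y : adjoint (shift a) (x, y) -> T (x, y + Num.conj a *: x).
  move=> h; apply: selfadjointI => // u v Tuv.
  have := h u (v - a *: u); rewrite /shift /= subrK => /(_ Tuv) /eqP.
  by rewrite innerBl innerZl innerDr innerZr conjCK subr_eq => /eqP.
have adj' a x y : T (x, y + Num.conj a *: x) -> adjoint (shift a) (x, y).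
  move=> Txy u w; rewrite /shift /= => Tuw.
  have /eqP := symmetricE saT Tuw Txy.
  by rewrite innerDl innerZl innerDr innerZr conjCK -subr_eq addrK => /eqP.
apply: (@closed_range_onto _ _ _ (shift z) (shift (Num.conj z)) c) => //.
- split; rewrite /shift /=; first by rewrite scaler0 addr0.
  + move=> a u v u' v' /= h h'; have := TL a _ _ _ _ h h'.
    by rewrite !scalerDr addrACA [a *: (z *: u)]scalerA mulrC -scalerA.
  + by move=> u v v' /= h h'; have := TF _ _ _ h h'; apply: addIr.
- apply/seteqP; split=> -[x y].
    by rewrite /shift /= => Txy; apply: adj'; rewrite conjCK.
  by move=> /adj; rewrite conjCK.
- move=> q /adj; rewrite add0r => Tq; have := low' _ _ Tq.
  rewrite subrr rnorm0 pmulr_rle0 // => q0; apply: rnorm_eq0.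
  by apply/eqP; rewrite eq_le q0 rnorm_ge0.
- by move=> u v /= /low; rewrite addrK.
Qed.

Lemma nonneg_rinner T u v : nonneg_oper T -> T (u, v) -> 0 <= rinner v u.
Proof. by move=> nT /nT; rewrite lecE => /andP[_]. Qed.

(** Here [r] is (1 + T)^-1 as a total function; it exists because Re (T u + u, u) >= |u|^2. Its
    bounds 0 <= r <= 1 let [bounded_sqrt] apply both to r and to 1 - r. *)
Lemma nonneg_resolvent T : selfadjoint T -> nonneg_oper T ->
  exists r : H -> H, [/\ forall f, T (r f, f - r f),
    forall u v, T (u, v) -> r (u + v) = u, symmetric_fun r
    & forall f, 0 <= rinner (r f) f <= rnorm f ^+ 2].
Proof.
move=> saT nT; have [[T0 TL TF] dT sT] := saT.
have low u v : T (u, v) -> 1 * rnorm u <= rnorm (v - (-1 : R[i]) *: u).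
  move=> /(nonneg_rinner nT) uv; rewrite scaleN1r opprK mul1r.
  have [->|u0] := eqVneq (rnorm u) 0; first exact: rnorm_ge0.
  have {}u0 : 0 < rnorm u by rewrite lt_def u0 rnorm_ge0.
  rewrite -(ler_pM2r u0) (le_trans _ (rinner_le _ _)) // rinnerDl rinner_sq.
  by rewrite -expr2 lerDr.
have /choice[r rP] : forall f, exists u, T (u, f - u).
  move=> f; have [|u] := @selfadjoint_shift_onto T (-1) 1 saT ltr01 low _ f.
    by rewrite rmorphN rmorph1.
  by rewrite scaleN1r; exists u.
have r_rinner f : rinner (r f) f = rinner (f - r f) (r f) + rnorm (r f) ^+ 2.
  by rewrite -rinner_sq -rinnerDl subrK rinnerC.
exists r; split => //.
- move=> u v Tuv; have h := linear_operB (And3 T0 TL TF) Tuv (rP (u + v)).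
  have := low _ _ h; rewrite scaleN1r opprK mul1r.
  have -> : v - (u + v - r (u + v)) + (u - r (u + v)) = 0.
    by rewrite !opprD opprK !addrA [v - u]addrC addrK [_ + u]addrAC addNr add0r subrr.
  rewrite rnorm0 => h0; apply/esym/eqP; rewrite -subr_eq0; apply/eqP/rnorm_eq0.
  by apply/eqP; rewrite eq_le h0 rnorm_ge0.
- move=> f g; have := symmetricE saT (rP f) (rP g).
  by rewrite innerBl innerBr => /addIr.
- move=> f; have h := nonneg_rinner nT (rP f).
  rewrite r_rinner addr_ge0 ?sqr_ge0 //=.
  have -> : rnorm f ^+ 2 = rnorm (f - r f + r f) ^+ 2 by rewrite subrK.
  by rewrite rnormD2 lerD2r -subr_ge0; have := sqr_ge0 (rnorm (f - r f)); lra.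
Qed.

Lemma symmetric_fun_ge0 (f : H -> H) x :
  symmetric_fun f -> 0 <= rinner (f x) x -> 0 <= inner H (f x) x.
Proof.
move=> sf h; rewrite lecE h andbT; apply/eqP/Im_eq0_conj.
by rewrite -innerC sf.
Qed.

Lemma inner_extr u v : (forall w, inner H w u = inner H w v) -> u = v.
Proof. by move=> h; apply: inner_ext => w; rewrite innerC h -innerC. Qed.

Definition graph (U V : hilbertSpace R) (f : U -> V) : oper U V :=
  [set p | p.2 = f p.1].

(* With [P^2 = (1 + T)^-1] and [Q^2 = 1 - P^2], the square root of [T] is
   [Q P^-1], i.e. the set of all [(P g, Q g)]. *)
Lemma nonneg_sqrt T : selfadjoint T -> nonneg_oper T ->
  exists A, [/\ selfadjoint A, nonneg_oper A & oper_comp A A = T].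
Proof.
move=> saT nT; have [r [rT rK symr r01]] := nonneg_resolvent saT nT.
have linr := symmetric_fun_linear symr.
have bs (f : H -> H) : symmetric_fun f -> norm_bounded f.
  by move=> sf; apply: adjoint_pair_bounded sf.
have [P [symP P01 PP comP]] := bounded_sqrt symr r01.
have symr' : symmetric_fun (fun x => x - r x).
  by move=> x y; rewrite innerBl innerBr symr.
have r01' x : 0 <= rinner (x - r x) x <= rnorm x ^+ 2.
  by rewrite rinnerBl rinner_sq subr_ge0 gerBl andbC.
have [Q [symQ Q01 QQ comQ]] := bounded_sqrt symr' r01'.
(* [P'] is the root of [P]. It gives nonnegativity of the constructed root of [T]: (Q g, P g) = (Q
   P' g, P' g) >= 0. *)
have [P' [symP' _ PP' comP']] := bounded_sqrt symP P01.
have [linP linQ linP'] : [/\ linear P, linear Q & linear P'].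
  by split; apply: symmetric_fun_linear.
have QP x : Q (P x) = P (Q x).
  apply: comP => //; first exact: bs.
  move=> y; apply/esym/comQ => //; first exact: bs.
  by move=> z; rewrite linear_funB.
have QP' x : Q (P' x) = P' (Q x) by apply: comP' => //; exact: bs.
have PQ1 x : P (P x) + Q (Q x) = x by rewrite PP QQ addrC subrK.
have Pinj x : P x = 0 -> x = 0.
  move=> Px; have r0 : r x = 0 by rewrite -PP Px linear_fun0.
  have := rT x; rewrite r0 subr0 => Tx; have [[T0 _ TF] _ _] := saT.
  exact: TF Tx T0.
pose A : oper H H := [set p | exists g, p = (P g, Q g)].
have AA : oper_comp A A = T.
  apply/seteqP; split=> -[x y] /=.
    move=> [v [g [-> ->]] [g' [e ->]]].
    (* As Q g = P g' and P^2 + Q^2 = 1, this vector satisfies P f = g and Q f = g', so (x, y) = (P^2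
       f, Q^2 f). *)
    pose f := P g + Q g'.
    have Pf : P f = g by rewrite /f linear_funD // -QP -e PQ1.
    have Qf : Q f = g'.
      apply/eqP; rewrite -subr_eq0; apply/eqP/Pinj.
      by rewrite linear_funB // -e -QP Pf subrr.
    by rewrite -[in X in T (P X, _)]Pf PP -Qf QQ.
  move=> Txy; exists (Q (P (x + y))).
    by exists (P (x + y)); rewrite PP (rK _ _ Txy).
  exists (Q (x + y)); rewrite QP QQ (rK _ _ Txy).
  by congr (_, _); rewrite addrAC subrr add0r.
exists A; split => //; last first.
  move=> _ _ [g [-> ->]]; rewrite -PP' -symP' -QP'.
  by apply: symmetric_fun_ge0 => //; have /andP[] := Q01 (P' g).
split.
- split; first by exists 0; rewrite !linear_fun0.
  + move=> a u v u' v' [g [-> ->]] [g' [-> ->]].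
    by exists (a *: g + g'); rewrite linP linQ.
  + move=> u v v' [g [-> ->]] [g' [/eqP e ->]].
    move: e; rewrite -subr_eq0 -linear_funB // => /eqP/Pinj/eqP.
    by rewrite subr_eq0 => /eqP ->.
- have [_ dT _] := saT; move=> O O0 oO; have [u [Ou [v]]] := dT O O0 oO.
  by rewrite -AA => -[w Auw _]; exists u; split => //; exists w.
- apply/seteqP; split=> -[x y] /=.
    (* The witness is forced: if (x, y) = (P g, Q g), then P x + Q y = g. *)
    move=> h; exists (P x + Q y).
    have e : Q x = P y.
      by apply: inner_extr => w; rewrite -symQ -symP; apply: h; exists w.
    rewrite (linear_funD _ _ linP) (linear_funD _ _ linQ).
    by rewrite -(QP y) -e PQ1 QP e PQ1.
  move=> [g [-> ->]] _ _ [g' [-> ->]].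
  by rewrite symP symQ QP.
Qed.

End SelfadjointOperators.

(** * The closed form of a nonnegative selfadjoint operator *)

Section OperApp.
Variables (R : realType) (U V : hilbertSpace R).
Implicit Types (T : oper U V) (u : U) (v : V).

Lemma oper_appE T u v : linear_oper T -> T (u, v) -> oper_app T u = v.
Proof.
move=> [_ _ TF] Tuv; apply: (TF u) => //; rewrite /oper_app.
by case: xgetP => // h; have := h v.
Qed.

Lemma oper_appP T u : oper_dom T u -> T (u, oper_app T u).
Proof. by case=> v Tuv; rewrite /oper_app; case: xgetP => [w -> //|h]; have := h v. Qed.

Lemma oper_dom_subspace T : linear_oper T -> lin_subspace (oper_dom T).
Proof.
move=> [T0 TL _]; split; first by exists 0.
by move=> a u u' [v Tv] [v' Tv']; exists (a *: v + v'); apply: TL.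
Qed.

Lemma oper_app_linear T (a : R[i]) u u' : linear_oper T ->
  oper_dom T u -> oper_dom T u' ->
  oper_app T (a *: u + u') = a *: oper_app T u + oper_app T u'.
Proof.
move=> linT Tu Tu'; apply: oper_appE => //; have [_ TL _] := linT.
by apply: TL; apply: oper_appP.
Qed.

End OperApp.

(* [form] is shadowed by the one of [sesquilinear]. *)
Local Notation form := Defs.form.

Section Form.
Variables (R : realType) (H : hilbertSpace R) (T : oper H H).
Hypotheses (saT : selfadjoint T) (nT : nonneg_oper T).
Implicit Types (u v w f x y : H).

Local Notation A := (oper_sqrt T).
Local Notation D := (form_dom T).

Lemma oper_sqrtP : [/\ selfadjoint A, nonneg_oper A & oper_comp A A = T].
Proof.
rewrite /oper_sqrt; case: xgetP => [B _ //|/= h].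
by have [B hB] := nonneg_sqrt saT nT; have := h B.
Qed.

Let saA : selfadjoint A. Proof. by case: oper_sqrtP. Qed.
Let linA : linear_oper A. Proof. by case: saA. Qed.

Lemma form_dom_subspace : lin_subspace D.
Proof. exact: oper_dom_subspace. Qed.

Lemma oper_dom_form_dom u v : T (u, v) -> D u.
Proof. by have [_ _ AA] := oper_sqrtP; rewrite -{1}AA => -[w Auw _]; exists w. Qed.

Lemma form_sym u v : form T u v = Num.conj (form T v u).
Proof. exact: innerC. Qed.

Lemma form_operE u w v : T (u, w) -> D v -> form T u v = inner H w v.
Proof.
have [_ _ AA] := oper_sqrtP; rewrite -{1}AA => -[x /= Aux Axw] Dv;
  rewrite /form (oper_appE linA Aux).
by rewrite -(symmetricE saA Axw (oper_appP Dv)).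
Qed.

Lemma form_sq u : form T u u = (qform T u)%:C.
Proof. by rewrite /qform /form innerE. Qed.

Lemma qform_ge0 u : 0 <= qform T u.
Proof. by rewrite /qform /form innerE sqr_ge0. Qed.

(** This is A + i with A the square root of [T]. Its squared norm is T[u] + |u|^2, so it identifies
    the form space with H and replaces any direct proof that D[T] is complete. *)
Definition form_iso u : H := oper_app A u + 'i *: u.

Lemma form_isoP (a : R[i]) u v : D u -> D v ->
  form_iso (a *: u + v) = a *: form_iso u + form_iso v.
Proof.
move=> Du Dv; rewrite /form_iso oper_app_linear // !scalerDr addrACA.
by rewrite !scalerA mulrC.
Qed.

Lemma form_innerE u v : D u -> D v ->
  form_inner T u v = inner H (form_iso u) (form_iso v).
Proof.
move=> Du Dv; rewrite /form_iso innerDl !innerDr !innerZl !innerZr.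
rewrite -(symmetricE saA (oper_appP Du) (oper_appP Dv)) /form_inner /form.
rewrite mulrA (_ : 'i * Num.conj 'i = 1) ?mul1r; last first.
  by apply/eqP; rewrite eq_complex /=; apply/andP; split; apply/eqP; simpc.
rewrite (_ : Num.conj 'i = - 'i :> R[i]); last first.
  by apply/eqP; rewrite eq_complex /= oppr0 !eqxx.
by rewrite mulNr addrA; congr (_ + _); rewrite subrK.
Qed.

Lemma form_iso_sq u : D u -> rnorm (form_iso u) ^+ 2 = qform T u + rnorm u ^+ 2.
Proof.
move=> Du; apply: complexI; rewrite -innerE -form_innerE // /form_inner innerE.
by rewrite form_sq rmorphD.
Qed.

(** Since (A u, u) is real, |A u - z u|^2 = |A u|^2 + |u|^2 for z = i and z = -i, which is the lower
    bound needed to solve (A + i) u = f. *)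
Lemma form_iso_onto f : exists2 u, D u & form_iso u = f.
Proof.
have low (z : R[i]) u v : z = 'i \/ z = - 'i -> A (u, v) ->
    1 * rnorm u <= rnorm (v - z *: u).
  move=> zi Auv; rewrite mul1r -(@ler_pXn2r _ 2) // ?nnegrE ?rnorm_ge0 //.
  have z1 : normc z = 1.
    have s1 (a b : R) : a ^+ 2 + b ^+ 2 = 1 -> Num.sqrt (a ^+ 2 + b ^+ 2) = 1.
      by move=> ->; rewrite sqrtr1.
    by case: zi => -> /=; apply: s1; ring.
  have [_ nA _] := oper_sqrtP; have := nA _ _ Auv.
  rewrite rnormB2 rnormZ z1 mul1r /rinner innerZr lecE => /andP[/eqP im0 _].
  have -> : complex.Re (Num.conj z * inner H v u) = 0.
    by move: im0; case: (inner H v u) => x y /= ->; case: zi => -> /=; ring.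
  by rewrite mulr0 subr0 lerDr sqr_ge0.
have [u] : exists u, A (u, f + (-'i) *: u).
  apply: (@selfadjoint_shift_onto _ _ _ _ 1) => //.
    by move=> u v; apply: low; right.
  by move=> u v; apply: low; left; apply/eqP; rewrite eq_complex /= opprK !oppr0 !eqxx.
by rewrite scaleNr => Au; exists u; [exists (f - 'i *: u)|rewrite /form_iso (oper_appE linA Au) subrK].
Qed.

(** The operator domain is dense in the form space: a vector orthogonal to it there vanishes, as
    testing against its own image under (1 + T)^-1 shows. *)
Lemma oper_dom_core u (e : R) : D u -> 0 < e ->
  exists2 w, oper_dom T w & rnorm (form_iso (u - w)) < e.
Proof.
move=> Du e0; have [linT _ _] := saT.
have [T0 TL TF] := linT.
pose V : set H := [set form_iso w | w in oper_dom T].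
have DV w : oper_dom T w -> D w by case=> v; apply: oper_dom_form_dom.
have sD := form_dom_subspace.
have j0 : form_iso 0 = 0.
  have := @form_isoP 1 0 0 sD.1 sD.1; rewrite !scale1r addr0 => /eqP.
  by rewrite -subr_eq0 opprD addrA subrr sub0r oppr_eq0 => /eqP.
have sV : lin_subspace V.
  split; first by exists 0 => //; exists 0.
  move=> a _ _ [w Tw <-] [w' Tw' <-]; exists (a *: w + w');
    last by rewrite form_isoP //; apply: DV.
  by have [_] := oper_dom_subspace linT; apply.
have [q [qV qf]] := projection (form_iso u) sV.
have q0 : q = 0.
  have [x Dx jx] := form_iso_onto q.
  have [r [rT _ _ _]] := nonneg_resolvent saT nT.
  (* Pairing x with (1 + T)^-1 x in the form inner product gives |x|^2. *)
  have Trx : oper_dom T (r x) by exists (x - r x).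
  have := qV (form_iso (r x)); rewrite -jx -form_innerE //; last exact: DV.
  rewrite /form_inner form_sym (form_operE (rT x) Dx) -innerC -innerDr subrK innerE => h.
  have /h/complexI/eqP : V (form_iso (r x)) by exists (r x).
  by rewrite sqrf_eq0 => /eqP/rnorm_eq0 ->.
have [_ [w Tw <-]] := qf e e0; rewrite q0 subr0 => h; exists w => //.
have := @form_isoP (-1) w u (DV _ Tw) Du.
by rewrite !scaleN1r ![- _ + _]addrC => ->.
Qed.

End Form.

(** * Boundary triplets and Weyl functions *)

Section Coercivity.
Variable R : realType.
Implicit Types z : R[i].

Lemma Im_conjE z : (2 * 'i)^-1 * (z - Num.conj z) = (complex.Im z)%:C.
Proof.
have i0 : 2 * 'i != 0 :> R[i].
  by rewrite mulf_neq0 ?pnatr_eq0 // eq_complex /= oner_eq0 andbF.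
by apply: (mulfI i0); rewrite mulVKf // subcJ mulrAC.
Qed.

Lemma off_halfline_conj z : off_halfline z -> off_halfline (Num.conj z).
Proof. by move=> zo; rewrite /off_halfline conjC_ge0. Qed.

(** The values z b - a fill the cone spanned by z and -1. This cone contains no line exactly when z
    is off [0, +oo), and then a factor [th] turns it into the open right half-plane, apart from its
    vertex. *)
Lemma off_halfline_coercive z : off_halfline z ->
  exists th : R[i], exists2 c : R, 0 < c & forall a b : R, 0 <= a -> 0 <= b ->
    c * (a + b) <= complex.Re (th * (z * b%:C - a%:C)).
Proof.
case: z => x y zo; have [x0|x0] := ltP x 0.
  exists (-1), (Num.min 1 (- x)); first by rewrite lt_min ltr01 oppr_gt0.
  move=> a b a0 b0 /=; rewrite !(mulr0, mul0r, subr0, oppr0, mulN1r).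
  have h1 : Num.min 1 (- x) * a <= a.
    by rewrite -[leRHS]mul1r ler_wpM2r // ge_min lexx.
  have h2 : Num.min 1 (- x) * b <= - x * b by rewrite ler_wpM2r // ge_min lexx orbT.
  by rewrite mulrDr; lra.
have y0 : y != 0.
  apply/negP => /eqP y0; apply: zo; rewrite lecE /= y0 eqxx //=.
(* This [th] is the solution of Re (th z) = 1 with Re th = -1, so the real part is exactly a + b. *)
exists ((-1) +i* (- ((x + 1) / y))), 1; first by [].
move=> a b a0 b0 /=; rewrite !(mulr0, mul0r, subr0, oppr0, mulN1r, add0r, addr0, mul1r).
rewrite mulNr opprK (_ : (x + 1) / y * (y * b) = (x + 1) * b); last by field.
by lra.
Qed.

(** Coercivity at z with b = 1 and a = w bounds |w - z| below for every real w >= 0. *)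
Lemma off_halfline_open z : off_halfline z ->
  exists2 d : R, 0 < d & forall w : R[i], normc (w - z) < d -> off_halfline w.
Proof.
move=> zo; have [th [c c0 hc]] := off_halfline_coercive zo.
have t0 : 0 < normc th + 1 by rewrite ltr_wpDl ?normc_ge0.
exists (c / (normc th + 1)); first by rewrite divr_gt0.
move=> w wz; rewrite /off_halfline lecE => /andP[/eqP w0 w1].
have wE : w = (complex.Re w)%:C by move: w0; case: (w) => a b /= ->.
have := hc _ 1 w1 ler01; rewrite -wE mulr1 => h.
have h1 := le_trans h (Re_le_normc _).
have : c <= normc th * normc (w - z).
  rewrite -normcM -normcN -mulrN opprB; apply: le_trans h1.
  by rewrite ler_peMr ?(ltW c0) // lerDr.
apply/negP; rewrite -ltNge; move: wz; rewrite ltr_pdivlMr //.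
by apply: le_lt_trans; rewrite mulrC ler_wpM2l ?normc_ge0 // lerDl.
Qed.

End Coercivity.

Section Adjoint.
Variables (R : realType) (U V : hilbertSpace R) (T : oper U V).

Lemma adjoint_linear : densely_defined T -> linear_oper (adjoint T).
Proof.
move=> dT; split.
- by move=> u v _ /=; rewrite !inner0r.
- by move=> a x y x' y' /= h h' u v Tuv; rewrite !innerDr !innerZr (h u v) // (h' u v).
- move=> x y y' /= h h'; apply/eqP; rewrite -subr_eq0; apply/eqP.
  apply: (dense_orthogonal0 dT) => u [v Tuv].
  by rewrite innerBr -(h u v) // -(h' u v) // subrr.
Qed.

Lemma oper_comp_id_sub (W : oper U U) (a : R[i]) u v :
  (W \-o (a \:o oper_id U)) (u, v) <-> W (u, v + a *: u).
Proof.
split=> [[w [x [Ww [y [y' y'E yE] xE] vE]]]|Wuv] /=.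
  move: y'E yE xE vE; rewrite /oper_id /= => -> -> -> ->.
  by rewrite scaleN1r subrK.
exists (v + a *: u), (- (a *: u)); split=> //=; last by rewrite addrK.
exists (a *: u); last by rewrite scaleN1r.
by exists u.
Qed.

End Adjoint.

Section Graph.
Variables (R : realType) (U V : hilbertSpace R).
Implicit Types f : U -> V.

Lemma oper_app_graph f u : oper_app (graph f) u = f u.
Proof. by rewrite /oper_app; case: xgetP => [v -> //|h]; have := h (f u) erefl. Qed.

Lemma linear_graph f : linear f -> linear_oper (graph f).
Proof.
move=> lf; rewrite /graph; split=> /=; first by rewrite linear_fun0.
  by move=> a u v u' v' /= -> ->; rewrite lf.
by move=> u v v' /= -> ->.
Qed.

Lemma oper_dom_graph f : oper_dom (graph f) = setT.
Proof. by apply/seteqP; split => // u _; exists (f u). Qed.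

Lemma bounded_graph f : linear f -> norm_bounded f -> bounded_oper (graph f).
Proof.
move=> lf [c c0 fc]; split; [exact: linear_graph | exact: oper_dom_graph |].
by exists c => u v; rewrite /graph /= => ->; rewrite !rnormE -rmorphM lecR.
Qed.

Lemma adjoint_graph f (f' : V -> U) :
  (forall u v, inner V (f u) v = inner U u (f' v)) -> adjoint (graph f) = graph f'.
Proof.
move=> ff'; apply/seteqP; split=> -[v u]; rewrite /graph /=.
  move=> h; apply: inner_extr => w; rewrite -ff'.
  by apply/esym/h.
by move=> -> w _ /= ->; rewrite ff'.
Qed.

End Graph.

Section BoundedFunctions.
Variable R : realType.

Lemma norm_bounded_pos (U V : hilbertSpace R) (f : U -> V) : norm_bounded f ->
  exists2 c : R, 0 < c & forall u, rnorm (f u) <= c * rnorm u.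
Proof.
move=> [c c0 fc]; exists (c + 1); first by rewrite ltr_wpDl.
by move=> u; rewrite (le_trans (fc u)) // ler_wpM2r ?rnorm_ge0 // lerDl.
Qed.

(* [rinner (A (x - s A x)) (x - s A x) >= 0] at [s = 1 / B]. *)
Lemma nonneg_symmetric_le (U : hilbertSpace R) (A : U -> U) (B : R) :
  symmetric_fun A -> 0 < B -> (forall x, 0 <= rinner (A x) x <= B * rnorm x ^+ 2) ->
  forall x, rnorm (A x) ^+ 2 <= B * rinner (A x) x.
Proof.
move=> sA B0 hA x; have lA := symmetric_fun_linear sA.
have /andP[+ _] := hA (x - (B^-1)%:C *: A x).
have /andP[_] := hA (A x).
rewrite linear_funB // linear_funZ // rinnerBl !rinnerBr !rinnerZl !rinnerZr.
have -> : rinner (A (A x)) x = rinner (A x) (A x) by rewrite /rinner sA.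
rewrite rinner_sq; set a := rnorm (A x) ^+ 2; set b := rinner (A x) x;
  set c := rinner (A (A x)) (A x).
move=> h1 h2; rewrite -subr_ge0 -(pmulr_rge0 _ (_ : 0 < B^-1)) ?invr_gt0 //.
have -> : B^-1 * (B * b - a) = b - B^-1 * a by rewrite mulrBr mulKf ?gt_eqF.
apply: (le_trans h2).
have : B^-1 * (B^-1 * c) <= B^-1 * a.
  have Bi : 0 <= B^-1 by rewrite invr_ge0 ltW.
  by rewrite ler_wpM2l // mulrC ler_pdivrMr // mulrC.
by move: (B^-1 * a) (B^-1 * (B^-1 * c)) => p q; lra.
Qed.

End BoundedFunctions.

(** * Cayley transforms and square roots of everywhere defined operators *)

Section Cayley.
Variables (R : realType) (H : hilbertSpace R).
Implicit Types (T : oper H H) (C r w : H -> H).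

Lemma oper_cayleyE T r : linear_oper T -> (forall f, T (r f, f - r f)) ->
  (forall u v, T (u, v) -> r (u + v) = u) ->
  oper_cayley T = graph (fun f => r f - (f - r f)).
Proof.
move=> linT rT rK; apply/seteqP; split=> -[f y]; rewrite /graph /=.
  move=> [v [a [b [aE Tb fE]]] [c [d [cE [d' Td' dE] yE]]]].
  move: aE Tb fE cE Td' dE yE; rewrite /oper_id /= => -> Tb -> -> Td' -> ->.
  by have [_ _ TF] := linT; rewrite (TF _ _ _ Td' Tb) rK // scaleN1r [v + b]addrC addrK.
move=> ->; exists (r f).
  by exists (r f), (f - r f); split => //=; rewrite addrC subrK.
exists (r f), (- (f - r f)); split => //=.
by exists (f - r f) => //=; rewrite scaleN1r.
Qed.

Lemma oper_sub_graph C r : graph C \-o graph r = graph (fun f => C f - r f).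
Proof.
apply/seteqP; split=> -[f y]; rewrite /graph /=.
  move=> [a [b [aE [b' b'E bE] yE]]]; move: aE b'E bE yE; rewrite /= => -> -> -> ->.
  by rewrite scaleN1r.
move=> ->; exists (C f), (- r f); split => //=.
by exists (r f) => //=; rewrite scaleN1r.
Qed.

Lemma selfadjoint_graph C : symmetric_fun C -> selfadjoint (graph C).
Proof.
move=> sC; split; first exact/linear_graph/symmetric_fun_linear.
  by move=> O [x Ox] _; rewrite oper_dom_graph setIT; exists x.
exact: adjoint_graph.
Qed.

(** Dividing by a norm bound brings C between 0 and 1, where [bounded_sqrt] applies. The root [p] so
    obtained only rules out the default value of [xget]; the function [w] is the chosen root itself,
    which is total because its square is. *)
Lemma oper_sqrt_graph C : symmetric_fun C -> (forall x, 0 <= rinner (C x) x) ->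
  exists w, [/\ oper_sqrt (graph C) = graph w, symmetric_fun w
    & forall x, w (w x) = C x].
Proof.
move=> sC C0; have lC := symmetric_fun_linear sC.
have [c c0 hc] := norm_bounded_pos (adjoint_pair_bounded sC).
pose C' x := (c^-1)%:C *: C x.
have sC' : symmetric_fun C' by move=> x y; rewrite innerZl innerZr conj_real sC.
have C'01 x : 0 <= rinner (C' x) x <= rnorm x ^+ 2.
  rewrite rinnerZl mulr_ge0 ?invr_ge0 ?(ltW c0) //= mulrC ler_pdivrMr //.
  rewrite (le_trans (rinner_le _ _)) // expr2 mulrC -mulrA ler_wpM2l ?rnorm_ge0 //.
  by rewrite mulrC.
have [P [sP P01 PP _]] := bounded_sqrt sC' C'01.
have lP := symmetric_fun_linear sP.
pose p x := (Num.sqrt c)%:C *: P x.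
have sp : symmetric_fun p by move=> x y; rewrite innerZl innerZr conj_real sP.
have pp x : p (p x) = C x.
  rewrite /p (linear_funZ _ _ lP) PP !scalerA -!rmorphM -expr2 sqr_sqrtr ?(ltW c0) //.
  by rewrite divff ?gt_eqF // scale1r.
have : [/\ selfadjoint (oper_sqrt (graph C)), nonneg_oper (oper_sqrt (graph C))
  & oper_comp (oper_sqrt (graph C)) (oper_sqrt (graph C)) = graph C].
  rewrite {1 2 3 4}/oper_sqrt; case: xgetP => [W _ //|/= n]; case: (n (graph p)); split.
  - exact: selfadjoint_graph.
  - move=> u v; rewrite /graph /= => ->; apply: symmetric_fun_ge0 => //=.
    by rewrite rinnerZl mulr_ge0 ?sqrtr_ge0 //; case/andP: (P01 u).
  - apply/seteqP; split=> -[f y]; rewrite /graph /=.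
      by move=> [v /= -> ->]; rewrite pp.
    by move=> ->; exists (p f) => //=; rewrite pp.
move: (oper_sqrt _) => W [saW _ WW].
have domW x : oper_dom W x.
  have : graph C (x, C x) by [].
  by rewrite -WW => -[v Wv _]; exists v.
have linW : linear_oper W by case: saW.
exists (oper_app W); split.
- apply/seteqP; split=> -[f y]; rewrite /graph /=.
    by move=> /(oper_appE linW) ->.
  by move=> ->; apply: oper_appP.
- by move=> x y; apply: symmetricE saW _ _; apply: oper_appP.
- move=> x; have : graph C (x, C x) by [].
  rewrite -WW => -[v /= /(oper_appE linW) -> /(oper_appE linW)] //.
Qed.

End Cayley.

(** * The boundary triplet, its gamma field and its Weyl function *)

Section BoundaryTriplet.
Variables (R : realType) (H K : hilbertSpace R).
Variables (S S0 S1 : oper H H) (G0 G1 : oper H K).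
Hypotheses (dS : densely_defined S).
Hypotheses (saS0 : selfadjoint S0) (nS0 : nonneg_oper S0) (SS0 : S `<=` S0).
Hypotheses (saS1 : selfadjoint S1) (nS1 : nonneg_oper S1) (SS1 : S `<=` S1).
Hypothesis S01 : closed_form_restriction S0 S1.
Hypothesis triplet : boundary_triplet S S0 S1 G0 G1.

Local Notation D0 := (form_dom S0).
Local Notation D1 := (form_dom S1).
Local Notation E := (form_ortho S0 S1).
Local Notation g0 := (oper_app G0).
Local Notation g1 := (oper_app G1).
Local Notation j := (form_iso S1).
Implicit Types (u v w e f : H) (h k : K) (z : R[i]).

Let pairG0 : boundary_pair S0 S1 G0. Proof. by case: triplet. Qed.
Let linG0 : linear_oper G0. Proof. by case: pairG0 => -[]. Qed.
Let domG0 : oper_dom G0 = D1. Proof. by case: pairG0 => -[]. Qed.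
Let linS0 : linear_oper S0. Proof. by case: saS0. Qed.
Let linS1 : linear_oper S1. Proof. by case: saS1. Qed.
Let D01 : D0 `<=` D1. Proof. by case: S01. Qed.
Let sD1 : lin_subspace D1. Proof. exact: form_dom_subspace. Qed.
Let sD0 : lin_subspace D0. Proof. exact: form_dom_subspace. Qed.

Lemma G0P u : D1 u -> G0 (u, g0 u).
Proof. by rewrite -domG0; apply: oper_appP. Qed.

Lemma g0_linear (a : R[i]) u v : D1 u -> D1 v -> g0 (a *: u + v) = a *: g0 u + g0 v.
Proof. by rewrite -domG0 => Du Dv; apply: oper_app_linear. Qed.

Lemma g0D u v : D1 u -> D1 v -> g0 (u + v) = g0 u + g0 v.
Proof. by move=> Du Dv; have := g0_linear 1 Du Dv; rewrite !scale1r. Qed.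

Lemma g0B u v : D1 u -> D1 v -> g0 (u - v) = g0 u - g0 v.
Proof.
by move=> Du Dv; have := g0_linear (-1) Dv Du; rewrite !scaleN1r ![- _ + _]addrC.
Qed.

Lemma g0_eq0 u : D1 u -> g0 u = 0 -> D0 u.
Proof.
by move=> Du g; have [_ _ <- _] := pairG0; rewrite /oper_ker /= -g; apply: G0P.
Qed.

Lemma g0_D0 u : D0 u -> g0 u = 0.
Proof. by have [_ _ <- _] := pairG0 => G0u; apply: oper_appE. Qed.

Lemma g0_bounded : exists2 c : R, 0 < c & forall u, D1 u -> rnorm (g0 u) <= c * rnorm (j u).
Proof.
have [_ [k hk] _ _] := pairG0; exists (`|k| + 1); first by rewrite ltr_wpDl.
move=> u Du; have := hk _ _ (G0P Du).
rewrite form_innerE // innerE rnormE -rmorphXn -rmorphM lecR => h.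
rewrite -(@ler_pXn2r _ 2) // ?nnegrE ?mulr_ge0 ?rnorm_ge0 ?addr_ge0 //.
apply: (le_trans h); rewrite exprMn ler_wpM2r ?sqr_ge0 //.
have := ler_norm k; have := normr_ge0 k; move: (`|k|) => a a0 ka.
by rewrite sqrrD; have := sqr_ge0 a; move: (a ^+ 2) => a2; lra.
Qed.

Lemma form_isoB u v : D1 u -> D1 v -> j (u - v) = j u - j v.
Proof.
move=> Du Dv; have := form_isoP saS1 nS1 (-1) Dv Du.
by rewrite !scaleN1r ![- _ + _]addrC.
Qed.

Lemma rnorm_le_form_iso u : D1 u -> rnorm u <= rnorm (j u).
Proof.
move=> Du; rewrite -(@ler_pXn2r _ 2) // ?nnegrE ?rnorm_ge0 //.
by rewrite form_iso_sq // lerDr qform_ge0.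
Qed.

Lemma form_iso_eq0 u : D1 u -> j u = 0 -> u = 0.
Proof.
move=> Du ju; apply: rnorm_eq0; apply/eqP; rewrite eq_le rnorm_ge0 andbT.
by rewrite (le_trans (rnorm_le_form_iso Du)) // ju rnorm0.
Qed.

Lemma E_D1 e : E e -> D1 e. Proof. by case. Qed.

(** The projection only puts u - e in the closure of D[S0]. That closure is D[S0], because D[S0] is
    the kernel of the continuous map Gamma_0. *)
Lemma form_ortho_decomp u : D1 u -> exists2 e, E e & D0 (u - e).
Proof.
move=> Du; pose V : set H := [set j w | w in D0].
have sV : lin_subspace V.
  split.
    exists 0; first exact: sD0.1.
    have := form_isoB sD1.1 sD1.1; rewrite subrr => ->; exact: subrr.
  move=> a _ _ [w Dw <-] [w' Dw' <-]; exists (a *: w + w'); first exact: sD0.2.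
  by rewrite form_isoP //; apply: D01.
have [q [qV qf]] := projection (j u) sV.
have [e De je] := form_iso_onto saS1 nS1 q; exists e.
  split=> // v Dv; rewrite form_innerE //; last exact: D01.
  by rewrite je; apply: qV; exists v.
have Due : D1 (u - e) by apply: lin_subspaceB.
have [c c0 gc] := g0_bounded.
apply: g0_eq0 => //; apply: rnorm_le_eps_eq0 => eps eps0.
have [_ [w Dw <-] h] := qf _ (divr_gt0 eps0 c0).
have -> : g0 (u - e) = g0 (u - e - w).
  by rewrite [RHS]g0B // ?(g0_D0 Dw) ?subr0 //; exact: D01.
have Dw1 := D01 Dw.
rewrite (le_trans (gc _ _)) //; first by apply: lin_subspaceB.
by rewrite !form_isoB // je mulrC -ler_pdivlMr // ltW.
Qed.

Lemma form_ortho_D0 e : E e -> D0 e -> e = 0.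
Proof.
move=> [De h] /h; rewrite form_innerE // innerE => /complexI/eqP.
by rewrite sqrf_eq0 => /eqP/rnorm_eq0; apply: form_iso_eq0.
Qed.

Lemma form_inner_sym u v : form_inner S1 u v = Num.conj (form_inner S1 v u).
Proof. by rewrite /form_inner (form_sym S1 u v) (innerC u v) rmorphD. Qed.

Lemma form_ortho_subspace : lin_subspace E.
Proof.
split.
  split; first exact: sD1.1.
  move=> v /D01 Dv; rewrite form_innerE //; last exact: sD1.1.
  have := form_isoB sD1.1 sD1.1; rewrite subrr => ->; by rewrite subrr inner0l.
move=> a u v [Du hu] [Dv hv]; split; first exact: sD1.2.
move=> w D0w; have D1w := D01 D0w; have := hu _ D0w; have := hv _ D0w.
rewrite !form_innerE //; last exact: sD1.2.
by move=> hv0 hu0; rewrite form_isoP // innerDl innerZl hu0 hv0 mulr0 addr0.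
Qed.

Lemma gamma_ex h : exists e, E e /\ g0 e = h.
Proof.
have [_ _ _ ran] := pairG0.
have [u G0u] : oper_ran G0 h by rewrite ran.
have Du : D1 u by rewrite -domG0; exists h.
have [e Ee D0ue] := form_ortho_decomp Du; exists e; split => //.
have := g0_D0 D0ue; rewrite g0B //; last exact: E_D1.
by move=> /eqP; rewrite subr_eq0 (oper_appE linG0 G0u) => /eqP.
Qed.

Definition gam h : H := xget 0 [set e | E e /\ g0 e = h].

Lemma gamP h : E (gam h) /\ g0 (gam h) = h.
Proof.
by rewrite /gam; case: xgetP => // n; have [e he] := gamma_ex h; have := n e.
Qed.

Lemma gam_E h : E (gam h). Proof. by case: (gamP h). Qed.
Lemma gam_D1 h : D1 (gam h). Proof. exact/E_D1/gam_E. Qed.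
Lemma gamK h : g0 (gam h) = h. Proof. by case: (gamP h). Qed.

Lemma gam_unique e : E e -> gam (g0 e) = e.
Proof.
move=> Ee; apply/eqP; rewrite -subr_eq0; apply/eqP.
have Ed : E (gam (g0 e) - e).
  by apply: lin_subspaceB => //; [exact: form_ortho_subspace | exact: gam_E].
apply: form_ortho_D0 => //; apply: g0_eq0; first exact: E_D1.
by rewrite g0B ?gamK ?subrr //; [exact: gam_D1 | exact: E_D1].
Qed.

Local Notation S' := (adjoint S).

Let linS' : linear_oper S'. Proof. exact: adjoint_linear. Qed.

Lemma S0_S' u v : S0 (u, v) -> S' (u, v).
Proof. by move=> S0uv x y /SS0 Sxy; apply: symmetricE saS0 Sxy S0uv. Qed.

Lemma S0_D0 u v : S0 (u, v) -> D0 u.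
Proof. exact: oper_dom_form_dom. Qed.

(** For x in dom S, which lies in D[S0], orthogonality reads (S x + x, e) = 0. *)
Lemma form_ortho_S' e : E e -> S' (e, - e).
Proof.
move=> [De he] x y Sxy; have D0x := S0_D0 (SS0 Sxy).
have := he _ D0x; rewrite form_inner_sym /form_inner (form_operE saS1 nS1 (SS1 Sxy) De).
by move=> /(congr1 Num.conj); rewrite conjCK rmorph0 innerNr => /eqP;
  rewrite addr_eq0 => /eqP.
Qed.

(** With a = (S0 u, u) and b = |u|^2, the number z b - a is (z u - S0 u, u), and Cauchy-Schwarz
    applies. *)
Lemma S0_coercive z : off_halfline z -> exists2 c : R, 0 < c &
  forall u v, S0 (u, v) -> c * rnorm u <= rnorm (v - z *: u).
Proof.
move=> /off_halfline_coercive[th [c c0 hc]].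
have t0 : 0 < normc th + 1 by rewrite ltr_wpDl ?normc_ge0.
exists (c / (normc th + 1)); first by rewrite divr_gt0.
move=> u v S0uv; have [->|u0] := eqVneq (rnorm u) 0; first by rewrite mulr0 rnorm_ge0.
have {}u0 : 0 < rnorm u by rewrite lt_def u0 rnorm_ge0.
have ge0 := nS0 S0uv; have [a a0 ea] : exists2 a : R, 0 <= a & inner H v u = a%:C.
  move: ge0; rewrite lecE; case: (inner H v u) => a b /= /andP[/eqP -> a0].
  by exists a.
rewrite mulrAC ler_pdivrMr // -(ler_pM2r u0).
have := hc a (rnorm u ^+ 2) a0 (sqr_ge0 _).
have -> : z * (rnorm u ^+ 2)%:C - a%:C = inner H (z *: u - v) u.
  by rewrite innerBl innerZl innerE ea.
have h := rinner_le_normc (z *: u - v) u th.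
move=> /le_trans -/(_ _ h); rewrite rnormBC => {}h.
rewrite -mulrA -expr2; apply: le_trans (_ : normc th * rnorm (v - z *: u) * rnorm u <= _).
  by apply: le_trans h; rewrite ler_pM2l // lerDr.
by rewrite ler_wpM2r ?rnorm_ge0 // mulrC ler_wpM2l ?rnorm_ge0 // lerDl.
Qed.

Definition res z f : H := xget 0 [set u | S0 (u, f + z *: u)].

Lemma S0_inj z u v u' v' : off_halfline z -> S0 (u, v) -> S0 (u', v') ->
  v - z *: u = v' - z *: u' -> u = u'.
Proof.
move=> /S0_coercive[c c0 hc] Suv Suv' e.
have := hc _ _ (linear_operB linS0 Suv Suv').
have -> : v - v' - z *: (u - u') = (v - z *: u) - (v' - z *: u').
  by rewrite scalerBr !opprB [X in _ + X = _]addrC addrACA [X in _ + X = _]addrC.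
rewrite e subrr rnorm0 pmulr_rle0 // => h; apply/eqP; rewrite -subr_eq0;
  apply/eqP/rnorm_eq0.
by apply/eqP; rewrite eq_le h rnorm_ge0.
Qed.

Lemma resP z f : off_halfline z -> S0 (res z f, f + z *: res z f).
Proof.
move=> zo; rewrite /res; case: xgetP => // n.
have [c c0 hc] := S0_coercive zo.
have [c' c'0 hc'] := S0_coercive (off_halfline_conj zo).
pose m := Num.min c c'; have m0 : 0 < m by rewrite lt_min c0.
have [||u Su] := @selfadjoint_shift_onto _ _ _ z m saS0 m0 _ _ f; last by have := n u.
- move=> u v Suv; rewrite (le_trans _ (hc _ _ Suv)) // ler_wpM2r ?rnorm_ge0 //.
  by rewrite ge_min lexx.
- move=> u v Suv; rewrite (le_trans _ (hc' _ _ Suv)) // ler_wpM2r ?rnorm_ge0 //.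
  by rewrite ge_min lexx orbT.
Qed.

Lemma res_unique z f u : off_halfline z -> S0 (u, f + z *: u) -> res z f = u.
Proof. by move=> zo Su; apply: S0_inj zo (resP f zo) Su _; rewrite !addrK. Qed.

Lemma res_linear z : off_halfline z -> linear (res z).
Proof.
move=> zo a f f'; apply: res_unique => //; have [_ SL _] := linS0.
have := SL a _ _ _ _ (resP f zo) (resP f' zo).
by rewrite !scalerDr addrACA [a *: (z *: _)]scalerA mulrC -scalerA.
Qed.

Lemma res_inner z f f' : off_halfline z ->
  inner H (res z f) f' = inner H f (res (Num.conj z) f').
Proof.
move=> zo; have := symmetricE saS0 (resP f zo) (resP f' (off_halfline_conj zo)).
by rewrite innerDl innerDr innerZl innerZr conjCK => /addIr.
Qed.

(* The [Gamma_0]-field at [z], see [gamma_fieldE]. *)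
Definition gamz z h : H := gam h + (1 + z) *: res z (gam h).

Lemma gamz_S' z h : off_halfline z -> S' (gamz z h, z *: gamz z h).
Proof.
move=> zo; have [_ SL _] := linS'.
have := SL (1 + z) _ _ _ _ (S0_S' (resP (gam h) zo)) (form_ortho_S' (gam_E h)).
rewrite /gamz addrC; congr (S' (_, _)).
rewrite !scalerDr !scalerA [z * (1 + z)]mulrC scalerDl scale1r addrAC.
by rewrite [gam h + _]addrC addrK.
Qed.

Lemma res_D0 z f : off_halfline z -> D0 (res z f).
Proof. by move=> zo; apply: S0_D0 (resP f zo). Qed.

Lemma gamz_D0 z h : off_halfline z -> D0 (gamz z h - gam h).
Proof. by move=> zo; rewrite /gamz addrAC subrr add0r; apply: lin_subspaceZ => //;
  apply: res_D0. Qed.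

Lemma gamz_D1 z h : off_halfline z -> D1 (gamz z h).
Proof.
move=> zo; rewrite -(subrK (gam h) (gamz z h)); apply: lin_subspaceD => //.
  exact/D01/gamz_D0.
exact: gam_D1.
Qed.

Lemma gamzK z h : off_halfline z -> g0 (gamz z h) = h.
Proof.
move=> zo; rewrite -{2}(gamK h); apply/eqP; rewrite -subr_eq0 -g0B.
- exact/eqP/g0_D0/gamz_D0.
- exact: gamz_D1.
- exact: gam_D1.
Qed.

Lemma gamz_L z h : off_halfline z -> triplet_dom S0 S1 (gamz z h).
Proof.
move=> zo; exists ((1 + z) *: res z (gam h)), (gam h); split.
- by apply: lin_subspaceZ; [exact: oper_dom_subspace | exists (gam h + z *: res z (gam h)); apply: resP].
- exact: gam_E.
- by rewrite addrC.
Qed.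

(** If u = v + e solves S^* u = z u with v in dom S0 and e in E, then Gamma_0 u = h forces e = gam
    h. Comparing S^* u = S0 v - e with z u leaves (S0 - z) v = (1 + z) e, which determines v. *)
Lemma gamma_fieldE z : off_halfline z -> gamma_field S S0 S1 G0 z = graph (gamz z).
Proof.
move=> zo; apply/seteqP; split=> -[h u] /=; last first.
  rewrite /graph /= => ->; split; last by rewrite -[X in G0 (_, X)](gamzK h zo);
    apply/G0P/gamz_D1.
  split; last exact: gamz_L.
  by apply/oper_comp_id_sub; rewrite add0r; apply: gamz_S'.
move=> [[/oper_comp_id_sub + [v [e [[v' S0v] Ee ue]]]] /= G0u]; move: ue => /= ue.
rewrite add0r /= ue => S'u; rewrite /graph /=.
have S'u' : S' (v + e, v' - e).
  have [_ SL _] := linS'; have := SL 1 _ _ _ _ (S0_S' S0v) (form_ortho_S' Ee).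
  by rewrite !scale1r.
have [_ _ SF] := linS'; have := SF _ _ _ S'u S'u' => e1.
have eh : e = gam h.
  have -> : h = g0 u by rewrite (oper_appE linG0 G0u).
  rewrite ue g0D ?(g0_D0 (S0_D0 S0v)) ?add0r ?gam_unique //.
    exact/D01/(S0_D0 S0v).
  exact: E_D1.
rewrite /gamz addrC -eh; congr (_ + _).
have [_ SL _] := linS0.
have S0r : S0 ((1 + z) *: res z e, (1 + z) *: (e + z *: res z e)).
  have [S00 _ _] := linS0; have := SL (1 + z) _ _ _ _ (resP e zo) S00.
  by rewrite !addr0.
apply: (S0_inj zo S0v S0r).
rewrite scalerDr [(1 + z) *: (z *: _)]scalerA [z *: ((1 + z) *: _)]scalerA mulrC addrK.
have -> : v' = z *: (v + e) + e by rewrite e1 subrK.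
by rewrite scalerDr addrAC [z *: v + _]addrC addrK scalerDl scale1r addrC.
Qed.

Definition weylz z h : K := g1 (gamz z h).

Lemma weyl_functionE z : off_halfline z ->
  weyl_function S S0 S1 G0 G1 z = graph (weylz z).
Proof.
move=> zo; rewrite /weyl_function gamma_fieldE //.
have [_ linG1 domG1 _] := triplet.
apply/seteqP; split=> -[h k]; rewrite /graph /=.
  by move=> [u /= -> /(oper_appE linG1) <-].
move=> ->; exists (gamz z h) => //=; apply: oper_appP.
by rewrite domG1; apply: gamz_L.
Qed.

Lemma weylzE z h v : off_halfline z -> D1 v ->
  inner K (weylz z h) (g0 v) = z * inner H (gamz z h) v - form S1 (gamz z h) v.
Proof.
move=> zo Dv; have [_ _ _ ->] := triplet; last first.
- by [].
- exact: gamz_L.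
rewrite (oper_appE linS' (gamz_S' h zo)) innerZl /weylz subKr //.
Qed.

Lemma off_halflineN1 : off_halfline (-1 : R[i]).
Proof. by rewrite /off_halfline oppr_ge0 ler10. Qed.

Lemma off_halfline_neg (t : R) : 0 < t -> off_halfline (- t%:C : R[i]).
Proof. by move=> t0; rewrite /off_halfline lecE /= oppr_ge0 [t <= 0]leNgt t0 andbF. Qed.

Lemma weylz_adjoint z : off_halfline z -> forall h k,
  inner K (weylz z h) k = inner K h (weylz (Num.conj z) k).
Proof.
move=> zo h k; have zo' := off_halfline_conj zo.
rewrite [RHS]innerC -{1}(gamzK k zo') -{2}(gamzK h zo).
rewrite !weylzE //; try exact: gamz_D1.
by rewrite rmorphB rmorphM /= conjCK -innerC -form_sym.
Qed.

Lemma weylz_linear z : off_halfline z -> linear (weylz z).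
Proof. by move=> zo; apply: adjoint_pair_linear (weylz_adjoint zo). Qed.

Lemma weylz_bounded z : off_halfline z -> norm_bounded (weylz z).
Proof. by move=> zo; apply: adjoint_pair_bounded (weylz_adjoint zo). Qed.

Lemma gamzN1 h : gamz (-1) h = gam h.
Proof. by rewrite /gamz subrr scale0r addr0. Qed.

Lemma weylN1E h v : D1 v ->
  inner K (weylz (-1) h) (g0 v) = - form_inner S1 (gam h) v.
Proof.
move=> Dv; rewrite weylzE //; last exact: off_halflineN1.
by rewrite gamzN1 /form_inner mulN1r opprD addrC.
Qed.

(** The squared form norm of [gam h] is -(M(-1) h, h), so boundedness of M(-1) replaces an appeal to
    the open mapping theorem. *)
Lemma gam_bounded : exists2 c : R, 0 < c & forall h, rnorm (j (gam h)) <= c * rnorm h.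
Proof.
have [c c0 hc] := norm_bounded_pos (weylz_bounded off_halflineN1).
exists (c + 1); first by rewrite ltr_wpDl // ltW.
have c1 : 0 <= c + 1 by rewrite addr_ge0 // ltW.
move=> h; rewrite -(@ler_pXn2r _ 2) // ?nnegrE ?mulr_ge0 ?rnorm_ge0 //.
have -> : rnorm (j (gam h)) ^+ 2 = - rinner (weylz (-1) h) h.
  have gD := gam_D1 h; have := weylN1E h gD; rewrite gamK /rinner => ->.
  by rewrite ReN opprK form_innerE // innerE.
rewrite -rinnerNl (le_trans (rinner_le _ _)) // rnormN.
have h0 := rnorm_ge0 h.
rewrite (le_trans (ler_wpM2r h0 (hc h))) // -mulrA -expr2 exprMn ler_wpM2r ?sqr_ge0 //.
by rewrite sqrrD; have := sqr_ge0 c; move: (c ^+ 2) => c2; lra.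
Qed.

Lemma weylz_diag z h : off_halfline z -> inner K (weylz z h) h =
  z * (rnorm (gamz z h) ^+ 2)%:C - (qform S1 (gamz z h))%:C.
Proof.
move=> zo; rewrite -{2}(gamzK h zo) weylzE //; last exact: gamz_D1.
by rewrite innerE form_sq.
Qed.

Lemma weylz_low z : off_halfline z ->
  exists2 c : R, 0 < c & forall h, c * rnorm h <= rnorm (weylz z h).
Proof.
move=> zo; have [th [c c0 hc]] := off_halfline_coercive zo.
have [k k0 hk] := g0_bounded; have t0 : 0 < normc th + 1 by rewrite ltr_wpDl ?normc_ge0.
exists (c / k ^+ 2 / (normc th + 1)); first by rewrite !divr_gt0 ?exprn_gt0.
move=> h; have [->|h0] := eqVneq (rnorm h) 0; first by rewrite mulr0 rnorm_ge0.
have {}h0 : 0 < rnorm h by rewrite lt_def h0 rnorm_ge0.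
rewrite mulrAC ler_pdivrMr // -(ler_pM2r h0).
have := hc _ _ (qform_ge0 S1 (gamz z h)) (sqr_ge0 (rnorm (gamz z h))).
rewrite -weylz_diag // -form_iso_sq //; last exact: gamz_D1.
move=> /le_trans -/(_ _ (rinner_le_normc _ _ _)) h1.
have h2 : rnorm h ^+ 2 <= k ^+ 2 * rnorm (j (gamz z h)) ^+ 2.
  have k0' := ltW k0.
  rewrite -exprMn ler_pXn2r // ?nnegrE ?mulr_ge0 ?rnorm_ge0 //.
  by rewrite -{1}(gamzK h zo) hk //; apply: gamz_D1.
apply: le_trans (_ : normc th * rnorm (weylz z h) * rnorm h <= _).
  apply: le_trans h1; rewrite -mulrA -expr2 mulrAC ler_pdivrMr ?exprn_gt0 //.
  by rewrite -mulrA ler_pM2l // mulrC.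
by rewrite ler_wpM2r ?rnorm_ge0 // mulrC ler_wpM2l ?rnorm_ge0 // lerDl.
Qed.

(** The lower bound at z gives injectivity and a closed range. The adjoint M(conj z) is injective by
    the bound at conj z, so the range is everything. *)
Lemma weylz_inv z : off_halfline z -> bounded_oper (oper_inv (graph (weylz z))).
Proof.
move=> zo; have zo' := off_halfline_conj zo.
have [c c0 hc] := weylz_low zo; have [c' c'0 hc'] := weylz_low zo'.
have lM := weylz_linear zo.
have inj h : weylz z h = 0 -> h = 0.
  move=> e; apply: rnorm_eq0; apply/eqP; rewrite eq_le rnorm_ge0 andbT.
  by rewrite -(pmulr_rle0 _ c0) (le_trans (hc h)) // e rnorm0.
split.
- split; rewrite /oper_inv /graph /=; first by rewrite linear_fun0.
  + by move=> a u v u' v' -> ->; rewrite lM.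
  + move=> u v v' -> /eqP; rewrite -subr_eq0 -linear_funB // => /eqP/inj/eqP.
    by rewrite subr_eq0 => /eqP.
- apply/seteqP; split => // k _.
  have [|||h] := @closed_range_onto _ _ _ (graph (weylz z)) (graph (weylz (Num.conj z))) c
    (linear_graph lM) _ _ c0 _ k; last by exists h.
  + apply/esym/adjoint_graph => u v.
    by rewrite weylz_adjoint // conjCK.
  + move=> q; rewrite (adjoint_graph (weylz_adjoint zo)) /graph /= => e.
    apply: rnorm_eq0; apply/eqP; rewrite eq_le rnorm_ge0 andbT.
    by rewrite -(pmulr_rle0 _ c'0) (le_trans (hc' q)) // -e rnorm0.
  + by move=> u v; rewrite /graph /= => ->.
- exists c^-1 => k h; rewrite /oper_inv /graph /= => ->.
  by rewrite !rnormE -rmorphM lecR mulrC ler_pdivlMr // mulrC.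
Qed.

(** * Holomorphy and the Herglotz-Nevanlinna property *)

Lemma res_bounded z : off_halfline z -> norm_bounded (res z).
Proof. by move=> zo; apply: adjoint_pair_bounded => u v; apply: res_inner. Qed.

Lemma gamz_bounded z : off_halfline z -> norm_bounded (gamz z).
Proof.
move=> zo; have [c c0 hc] := gam_bounded; have [r r0 hr] := res_bounded zo.
have cg h : rnorm (gam h) <= c * rnorm h.
  by apply: le_trans (hc h); apply/rnorm_le_form_iso/gam_D1.
exists (c + normc (1 + z) * (r * c)).
  by rewrite addr_ge0 ?mulr_ge0 ?normc_ge0 // ltW.
move=> h; rewrite /gamz (le_trans (rnormD _ _)) // mulrDl lerD //.
rewrite rnormZ -mulrA ler_wpM2l ?normc_ge0 // (le_trans (hr _)) //.
by rewrite -mulrA ler_wpM2l.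
Qed.

Lemma gamz_diff z (w : R[i]) h : off_halfline z -> off_halfline w ->
  gamz w h - gamz z h = (w - z) *: res w (gamz z h).
Proof.
move=> zo wo; have lr := res_linear wo.
rewrite -(linear_funZ _ _ lr) /gamz; set e := gam h.
have [_ SL _] := linS0; have [S00 _ _] := linS0.
rewrite opprD addrACA subrr add0r; apply/esym/res_unique => //.
have := linear_operB linS0 (SL (1 + w) _ _ _ _ (resP e wo) S00)
  (SL (1 + z) _ _ _ _ (resP e zo) S00).
rewrite !addr0; congr (S0 (_, _)).
set x := res w e; set y := res z e.
by apply: inner_ext => f; rewrite !(innerBl, innerDl, innerZl); ring.
Qed.

(** If S0 - z is bounded below by c, then S0 - w is bounded below by c / 2 for |w - z| < c / 2. This
    uniformity in w is what the derivative estimate needs. *)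
Lemma res_locally_bounded z : off_halfline z -> exists2 C : R, 0 < C &
  exists2 d : R, 0 < d & forall w : R[i], normc (w - z) < d ->
    off_halfline w /\ forall f, rnorm (res w f) <= C * rnorm f.
Proof.
move=> zo; have [c c0 hc] := S0_coercive zo.
have [d d0 hd] := off_halfline_open zo.
exists (2 / c); first by rewrite divr_gt0.
exists (Num.min d (c / 2)); first by rewrite lt_min d0 divr_gt0.
move=> w; rewrite lt_min => /andP[/hd wo wz]; split => // f.
have := hc _ _ (resP f wo); set u := res w f.
have -> : f + w *: u - z *: u = f + (w - z) *: u by rewrite scalerBl addrA.
move=> /le_trans -/(_ _ (rnormD _ _)); rewrite rnormZ => h.
have h1 : normc (w - z) * rnorm u <= c / 2 * rnorm u.
  by rewrite ler_wpM2r ?rnorm_ge0 // ltW.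
by rewrite mulrAC ler_pdivlMr // mulrC; lra.
Qed.

Lemma weylz_diff z (w : R[i]) h k : off_halfline z -> off_halfline w ->
  inner K (weylz w h - weylz z h) k =
  (w - z) * inner H (gamz w h) (gamz (Num.conj z) k).
Proof.
move=> zo wo; have zo' := off_halfline_conj zo.
rewrite innerBl (weylz_adjoint zo) [inner K h _]innerC.
rewrite -{1}(gamzK k zo') -{2}(gamzK h wo) !weylzE //; try exact: gamz_D1.
rewrite rmorphB rmorphM /= conjCK -innerC -form_sym.
by rewrite mulrBl opprB addrA subrK.
Qed.

(** The formula is f -> -M(-1) Gamma_0 (1 + S1)^-1 f. It works because (1 + S1)^-1 f represents f in
    the form inner product of S1, where M(-1) pairs with [gam]. *)
Lemma gam_adjoint_ex : exists g : H -> K, forall f k,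
  inner K (g f) k = inner H f (gam k).
Proof.
have [r [rS1 _ _ _]] := nonneg_resolvent saS1 nS1.
exists (fun f => - weylz (-1) (g0 (r f))) => f k.
have Dr : D1 (r f) by apply: oper_dom_form_dom (rS1 f).
rewrite innerNl weylz_adjoint; last exact: off_halflineN1.
rewrite rmorphN rmorph1 innerC weylN1E // rmorphN /= opprK -form_inner_sym.
by rewrite /form_inner (form_operE saS1 nS1 (rS1 f) (gam_D1 k)) -innerDl subrK.
Qed.

Lemma gamz_adjoint_ex z : off_halfline z -> exists g : H -> K, forall f k,
  inner K (g f) k = inner H f (gamz (Num.conj z) k).
Proof.
move=> zo; have [g hg] := gam_adjoint_ex.
exists (fun f => g (f + (1 + z) *: res z f)) => f k.
rewrite hg /gamz innerDl innerDr innerZl innerZr res_inner //.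
by rewrite rmorphD rmorph1 /= conjCK.
Qed.

(** The derivative is u(conj z)^* u(z). By [weylz_diff] the error of the difference quotient is
    u(conj z)^* (u(w) - u(z)), and [gamz_diff] makes the last factor of order |w - z|. *)
Lemma weylz_derivative z : off_halfline z ->
  exists2 D : K -> K, linear D /\ norm_bounded D &
  exists2 C : R, 0 < C & exists2 d : R, 0 < d & forall w : R[i], w != z -> normc (w - z) < d ->
    forall h, rnorm ((w - z)^-1 *: (weylz w h - weylz z h) - D h)
      <= C * normc (w - z) * rnorm h.
Proof.
move=> zo; have zo' := off_halfline_conj zo.
have [g hg] := gamz_adjoint_ex zo; have [g' hg'] := gamz_adjoint_ex zo'.
have DD' h k : inner K (g (gamz z h)) k = inner K h (g' (gamz (Num.conj z) k)).
  by rewrite hg [RHS]innerC hg' conjCK -innerC.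
exists (fun h => g (gamz z h)).
  by split; [apply: adjoint_pair_linear DD' | apply: adjoint_pair_bounded DD'].
have [C1 C10 [d d0 hd]] := res_locally_bounded zo.
have [C2 C20 h2] := norm_bounded_pos (gamz_bounded zo).
have [C3 C30 h3] := norm_bounded_pos (gamz_bounded zo').
exists (C1 * C2 * C3); first by rewrite !mulr_gt0.
exists d => // w wz /hd[wo h1] h; set q := (X in rnorm X).
have e k : inner K q k = inner H (gamz w h - gamz z h) (gamz (Num.conj z) k).
  rewrite [LHS]innerBl innerZl weylz_diff // hg mulKf ?subr_eq0 //.
  by rewrite -innerBl.
have [->|q0] := eqVneq (rnorm q) 0.
  by rewrite !mulr_ge0 ?normc_ge0 ?rnorm_ge0 // ltW.
have {}q0 : 0 < rnorm q by rewrite lt_def q0 rnorm_ge0.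
rewrite -(ler_pM2r q0) -expr2 -rinner_sq /rinner e -/(rinner _ _).
rewrite (le_trans (rinner_le _ _)) // gamz_diff // rnormZ.
apply: le_trans (_ : normc (w - z) * (C1 * (C2 * rnorm h)) * (C3 * rnorm q) <= _).
  rewrite ler_pM ?mulr_ge0 ?normc_ge0 ?rnorm_ge0 // ler_wpM2l ?normc_ge0 //.
  by rewrite (le_trans (h1 _)) // ler_pM2l.
by rewrite le_eqVlt; apply/orP; left; apply/eqP; ring.
Qed.

Local Notation M := (weyl_function S S0 S1 G0 G1).

Lemma weyl_herglotz : herglotz_nevanlinna M.
Proof.
move=> z zo; have zo' := off_halfline_conj zo; split.
- by rewrite weyl_functionE //; apply: bounded_graph;
  [exact: weylz_linear | exact: weylz_bounded].
- have [D [lD bD] [C C0 [d d0 hd]]] := weylz_derivative zo.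
  exists (graph D); first exact: bounded_graph.
  have [d' d'0 hd'] := off_halfline_open zo.
  move=> e e0; exists (Num.min (Num.min d d') (e / C)).
    by rewrite !lt_min d0 d'0 divr_gt0.
  move=> w; rewrite normcRE => /andP[wz]; rewrite ltcR !lt_min -andbA =>
    /and3P[wd wd' we] h.
  rewrite !weyl_functionE //; last exact: hd'.
  rewrite !oper_app_graph !rnormE -rmorphM lecR.
  rewrite (le_trans (hd w _ wd h)) //.
    by move: wz; rewrite -normcRE normr_gt0 subr_eq0.
  by rewrite ler_wpM2r ?rnorm_ge0 // mulrC -ler_pdivlMr // ltW.
- rewrite !weyl_functionE // (adjoint_graph (weylz_adjoint zo)) //.
- rewrite weyl_functionE // /oper_im (adjoint_graph (weylz_adjoint zo)).
  move=> u x [v [y [a [b [aE [b' b'E bE] yE]]] vE] xE].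
  move: aE b'E bE yE vE xE; rewrite /graph /= => -> -> -> -> -> ->.
  rewrite scaleN1r !innerZl innerBl (weylz_adjoint zo') conjCK.
  rewrite [inner K u _]innerC Im_conjE weylz_diag //.
  set q := qform _ _; set n := rnorm _ ^+ 2.
  (* The form value [q] is real, so the imaginary part of (M(z) h, h) is Im z times |u(z)|^2; the
     extra factor Im z completes a square. *)
  have -> : complex.Im (z * n%:C - q%:C) = complex.Im z * n.
    by case: (z) => x1 y1 /=; ring.
  by rewrite -rmorphM mulrA -expr2 lecR mulr_ge0 ?sqr_ge0.
Qed.

Lemma weyl_inv_bounded z : off_halfline z -> bounded_oper (oper_inv (M z)).
Proof. by move=> zo; rewrite weyl_functionE //; apply: weylz_inv. Qed.

(** * The Weyl function on the negative axis and its limits *)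

Section NegativeAxis.
Variable t : R.
Hypothesis t0 : 0 < t.

Local Notation zt := (- t%:C : R[i]).

Let zo : off_halfline zt. Proof. exact: off_halfline_neg. Qed.

Definition energy h : R := qform S1 (gamz zt h) + t * rnorm (gamz zt h) ^+ 2.

Lemma energy_ge0 h : 0 <= energy h.
Proof. by rewrite addr_ge0 ?qform_ge0 // mulr_ge0 ?sqr_ge0 // ltW. Qed.

Lemma weylz_energy h : rinner (weylz zt h) h = - energy h.
Proof.
rewrite /rinner weylz_diag // mulNr -rmorphM ReD !ReN !ReC /energy.
by rewrite opprD addrC.
Qed.

Lemma weylz_neg_symmetric : symmetric_fun (weylz zt).
Proof. by move=> h k; rewrite weylz_adjoint // rmorphN /= conj_real. Qed.

Lemma qformD u v : D1 u -> D1 v -> qform S1 (u + v) =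
  qform S1 u + 2 * complex.Re (form S1 u v) + qform S1 v.
Proof.
move=> Du Dv; rewrite /qform -[in LHS](scale1r u) /form.
have [[linA _ _] _ _] := oper_sqrtP saS1 nS1.
by rewrite oper_app_linear // scale1r !innerE rnormD2.
Qed.

(* [gamz zt h] is orthogonal to [ker g0] for the form [S1[u, v] + t (u, v)]. *)
Lemma energy_min u : D1 u -> energy (g0 u) <= qform S1 u + t * rnorm u ^+ 2.
Proof.
move=> Du; set h := g0 u; pose w := gamz zt h; pose p := u - w.
have Dw : D1 w by apply: gamz_D1.
have Dp : D1 p by apply: lin_subspaceB.
have p0 : g0 p = 0 by rewrite g0B // gamzK // subrr.
have orth : complex.Re (form S1 w p) + t * rinner w p = 0.
  have := weylzE h zo Dp; rewrite p0 inner0r mulNr => /(congr1 (@complex.Re R)).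
  rewrite ReD !ReN ReZ /rinner => /eqP; rewrite eq_sym -opprD oppr_eq0 addrC.
  by move=> /eqP.
have -> : u = w + p by rewrite /p addrC subrK.
rewrite qformD // rnormD2 /energy -/w.
have := qform_ge0 S1 p; have : 0 <= t * rnorm p ^+ 2.
  by rewrite mulr_ge0 ?sqr_ge0 // ltW.
move: orth; lra.
Qed.

End NegativeAxis.

(** Testing the minimum at [gam k] bounds the form of -M(-t) by c^2 (1 + t) |k|^2, and
    [nonneg_symmetric_le] then controls norms by energies. Limits of the energy thereby become
    strong limits of M. *)
Lemma weylz_neg_le : exists2 B : R, 0 < B & forall t, 0 < t -> forall h,
  rnorm (weylz (- t%:C) h) ^+ 2 <= B * (1 + t) * energy t h.
Proof.
have [c c0 hc] := gam_bounded; exists (c ^+ 2); first by rewrite exprn_gt0.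
move=> t t0 h; have B0 : 0 < c ^+ 2 * (1 + t) by rewrite mulr_gt0 ?exprn_gt0 ?addr_gt0.
pose A k := - weylz (- t%:C) k.
have sA : symmetric_fun A.
  by move=> x y; rewrite innerNl innerNr weylz_neg_symmetric.
have AE k : rinner (A k) k = energy t k by rewrite rinnerNl weylz_energy // opprK.
have := @nonneg_symmetric_le _ _ A _ sA B0 _ h; rewrite AE rnormN; apply => k.
rewrite AE energy_ge0 //=; have Dk := gam_D1 k.
have := energy_min t0 Dk; rewrite gamK => /le_trans; apply.
have h1 : rnorm (j (gam k)) ^+ 2 <= c ^+ 2 * rnorm k ^+ 2.
  by rewrite -exprMn ler_pXn2r ?nnegrE ?mulr_ge0 ?rnorm_ge0 // ltW.
rewrite mulrAC mulrDr mulr1 lerD //.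
  by rewrite (le_trans _ h1) // form_iso_sq // lerDl sqr_ge0.
rewrite mulrC ler_pM2r // (le_trans _ h1) // form_iso_sq // lerDr qform_ge0 //.
Qed.

(** By density of dom S, subtracting from [gam g] an element of D[S0] gives a competitor u of
    arbitrarily small norm with Gamma_0 u = g; hence energy t g <= S1[u] + t |u|^2 is o(t). The 4 in
    [eta] absorbs 1 + t <= 4 t. *)
Lemma weylz_large (g : K) : forall e : R, 0 < e -> exists2 T : R, 1 < T &
  forall t, T < t -> rnorm (weylz (- t%:C) g) < e * t.
Proof.
move=> e e0; have [B B0 hB] := weylz_neg_le.
pose eta := e ^+ 2 / (4 * B); have eta0 : 0 < eta by rewrite divr_gt0 ?exprn_gt0 ?mulr_gt0.
have s0 : 0 < Num.sqrt eta by rewrite sqrtr_gt0.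
have [f [v Sfv] hf] := dense_approx (gam g) dS s0.
have D0f : D0 f by apply: S0_D0 (SS0 Sfv).
pose u := gam g - f; have Du : D1 u by apply: lin_subspaceB; [|exact: gam_D1|exact: D01].
have gu : g0 u = g by rewrite g0B ?(g0_D0 D0f) ?subr0 ?gamK //;
  [exact: gam_D1|exact: D01].
have u2 : rnorm u ^+ 2 < eta.
  by rewrite -(sqr_sqrtr (ltW eta0)) ltr_pXn2r ?nnegrE ?rnorm_ge0 // ltW.
exists (Num.max 2 (qform S1 u / (eta - rnorm u ^+ 2))); first by rewrite lt_max ltr1n.
move=> t; rewrite gt_max => /andP[t2 tq].
have t0 : 0 < t by apply: lt_trans t2.
have t1 : 1 < t by apply: lt_trans t2; rewrite ltr1n.
apply: sqr_lt_norm; [exact: rnorm_ge0 | exact: mulr_gt0 |].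
rewrite (le_lt_trans (hB t t0 g)) //.
have he : energy t g < t * eta.
  have := energy_min t0 Du; rewrite gu => /le_lt_trans; apply.
  by rewrite -ltrBrDr -mulrBr -ltr_pdivrMr // subr_gt0.
apply: lt_le_trans (_ : B * (1 + t) * (t * eta) <= _).
  by rewrite ltr_pM2l // mulr_gt0 // addr_gt0.
have -> : B * (1 + t) * (t * eta) = e ^+ 2 * t * ((1 + t) / 4).
  by rewrite /eta; field; rewrite gt_eqF.
by rewrite exprMn expr2 -!mulrA !ler_pM2l //; lra.
Qed.

(** Writing g = -M(-1) k turns |g|^2 into the form inner product of [gam k] with u = u(-t). If the
    energy stayed below C, then u would be bounded in form norm with |u|^2 <= C / t; replacing
    [gam k] by a nearby w in dom S1 gives (S1 w + w, u), which is too small for large t. *)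
Lemma weylz_energy_unbounded (g : K) : g != 0 -> forall A : R,
  exists T : R, forall t, T < t -> 0 < t /\ A < energy t g.
Proof.
move=> g0' A.
have [k kg] : exists k, g = - weylz (-1) k.
  have [_ dom _] := weylz_inv off_halflineN1.
  have [k hk] : oper_dom (oper_inv (graph (weylz (-1)))) (- g) by rewrite dom.
  by exists k; move: hk; rewrite /oper_inv /graph /= => <-; rewrite opprK.
have ng : 0 < rnorm g.
  by rewrite lt_def rnorm_ge0 andbT; apply: contra_neq g0' => /rnorm_eq0.
pose C := Num.max 1 A; have C0 : 0 < C by rewrite lt_max ltr01.
pose s := Num.sqrt C; have s0 : 0 < s by rewrite sqrtr_gt0.
(* Multiplied by the bound [s] on the form norm of u, this error is half of |g|^2. *)
have e0 : 0 < rnorm g ^+ 2 / (2 * s) by rewrite divr_gt0 ?exprn_gt0 ?mulr_gt0.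
have [w [w' S1w] hw] := oper_dom_core saS1 nS1 (gam_D1 k) e0.
have Dw : D1 w by apply: oper_dom_form_dom S1w.
set q := rnorm (w' + w) ^+ 2.
(* Beyond this threshold, q C / t is below (|g|^2 / 2)^2. *)
exists (Num.max 1 (4 * C * q / rnorm g ^+ 4)) => t; rewrite gt_max => /andP[t1 tq].
have t0 : 0 < t by apply: lt_trans t1.
have zo := off_halfline_neg t0.
split => //; rewrite ltNge; apply/negP => leA.
have leC : energy t g <= C by rewrite (le_trans leA) // le_max lexx orbT.
pose u := gamz (- t%:C) g; have Du : D1 u by apply: gamz_D1.
have ju : rnorm (j u) <= s.
  have [s0' C0'] : 0 <= s /\ 0 <= C by rewrite !ltW.
  rewrite -(@ler_pXn2r _ 2) // ?nnegrE ?rnorm_ge0 // sqr_sqrtr //.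
  rewrite form_iso_sq // (le_trans _ leC) // /energy lerD2l.
  by rewrite ler_peMl ?sqr_ge0 // ltW.
have nu : rnorm u ^+ 2 <= C / t.
  rewrite ler_pdivlMr // mulrC (le_trans _ leC) // /energy lerDr qform_ge0 //.
have : rnorm g ^+ 2 = rinner (j (gam k)) (j u).
  rewrite /rinner -form_innerE //; last exact: gam_D1.
  rewrite -rinner_sq {1}kg rinnerNl /rinner -{1}(gamzK g zo) weylN1E // ReN opprK //.
have -> : j (gam k) = j (gam k - w) + j w by rewrite form_isoB ?subrK //; exact: gam_D1.
rewrite rinnerDl.
have -> : rinner (j w) (j u) = rinner (w' + w) u.
  by rewrite /rinner -form_innerE // /form_inner (form_operE saS1 nS1 S1w Du) innerDl.
have h1 : rinner (j (gam k - w)) (j u) < rnorm g ^+ 2 / 2.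
  rewrite (le_lt_trans (rinner_le _ _)) //.
  apply: le_lt_trans (_ : rnorm (j (gam k - w)) * s < _).
    by rewrite ler_wpM2l ?rnorm_ge0.
  by rewrite -ltr_pdivlMr //; move: hw; rewrite invfM mulrA.
have h2 : rinner (w' + w) u < rnorm g ^+ 2 / 2.
  rewrite (le_lt_trans (rinner_le _ _)) //.
  apply: sqr_lt_norm; [by rewrite mulr_ge0 ?rnorm_ge0 | by rewrite divr_gt0 ?exprn_gt0 |].
  rewrite exprMn -/q (le_lt_trans (ler_wpM2l (sqr_ge0 _) nu)) // -/q.
  rewrite mulrA ltr_pdivrMr //; move: tq; rewrite ltr_pdivrMr ?exprn_gt0 // => tq.
  by rewrite expr_div_n -exprM; move: tq; lra.
lra.
Qed.

(** The infimum condition supplies a competitor u for the boundary value g with S1[u] below [eta],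
    and t |u|^2 is negligible for small t. The 2 in [eta] absorbs 1 + t <= 2. *)
Lemma weylz_small (g : K) :
  (forall u, D1 u -> inf [set qform S1 (u - f) | f in D0] = 0) ->
  forall e : R, 0 < e -> exists2 d : R, 0 < d &
    forall t, 0 < t -> t < d -> rnorm (weylz (- t%:C) g) < e.
Proof.
move=> inf0 e e0; have [B B0 hB] := weylz_neg_le.
pose eta := e ^+ 2 / (2 * B); have eta0 : 0 < eta by rewrite divr_gt0 ?exprn_gt0 ?mulr_gt0.
have [f D0f hf] : exists2 f, D0 f & qform S1 (gam g - f) < eta.
  have hE : has_inf [set qform S1 (gam g - f) | f in D0].
    split; first by exists (qform S1 (gam g - 0)); exists 0 => //; exact: sD0.1.
    by exists 0 => _ [f _ <-]; apply: qform_ge0.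
  have [_ [f D0f <-]] := inf_adherent eta0 hE.
  by rewrite inf0 ?add0r; [exists f | exact: gam_D1].
pose u := gam g - f; have Du : D1 u by apply: lin_subspaceB; [|exact: gam_D1|exact: D01].
have gu : g0 u = g by rewrite g0B ?(g0_D0 D0f) ?subr0 ?gamK //;
  [exact: gam_D1|exact: D01].
have n1 : 0 < rnorm u ^+ 2 + 1 by rewrite ltr_wpDl ?sqr_ge0.
exists (Num.min 1 ((eta - qform S1 u) / (rnorm u ^+ 2 + 1))).
  by rewrite lt_min ltr01 divr_gt0 ?subr_gt0.
move=> t t0; rewrite lt_min => /andP[t1]; rewrite ltr_pdivlMr // => tq.
apply: sqr_lt_norm => //; first exact: rnorm_ge0.
rewrite (le_lt_trans (hB t t0 g)) //.
have he : energy t g < eta.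
  have := energy_min t0 Du; rewrite gu => /le_lt_trans; apply.
  by move: tq; rewrite mulrDr mulr1; move: (t * _) => y; lra.
apply: le_lt_trans (_ : B * 2 * energy t g < _).
  by rewrite ler_wpM2r ?energy_ge0 // ler_pM2l //; lra.
by move: he; rewrite /eta ltr_pdivlMr ?mulr_gt0 // mulrC [B * 2]mulrC.
Qed.

Lemma weyl_class_SF :
  (forall u, D1 u -> inf [set qform S1 (u - f) | f in D0] = 0) -> class_SF M.
Proof.
move=> inf0.
have ME x : x < 0 -> M x%:C = graph (weylz (- (- x)%:C)).
  move=> x0; rewrite -weyl_functionE ?rmorphN ?opprK //.
  by have := @off_halfline_neg (- x); rewrite oppr_gt0 rmorphN opprK; apply.
split.
- exact: weyl_herglotz.
- exact: weyl_inv_bounded.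
- move=> g; apply/cvgrPdist_lt => eps.
  rewrite ltcE /= => /andP[/eqP im0 e0].
  have epsE : eps = (complex.Re eps)%:C by move: im0; case: (eps) => a b /= ->.
  have [d d0 hd] := weylz_small g inf0 e0.
  near=> x.
  have x0 : x < 0 by near: x; exact: nbhs_left_lt.
  have xd : - d < x by near: x; apply: nbhs_left_gt; rewrite oppr_lt0.
  rewrite ME // oper_app_graph sub0r normrN rnormE epsE ltcR hd ?oppr_gt0 //.
  by rewrite ltrNl.
- move=> g g0'; apply/cvgrNyPlt => A.
  have [T hT] := weylz_energy_unbounded g0' (- A).
  near=> x.
  have xT : x < - T by near: x; apply: nbhs_ninfty_lt; rewrite num_real.
  have [] := hT (- x); first by rewrite ltrNr.
  rewrite oppr_gt0 => x0 hA; rewrite ME // oper_app_graph.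
  by rewrite -/(rinner _ _) weylz_energy ?oppr_gt0 // ltrNl.
- move=> g; apply/cvgrPdist_lt => eps.
  rewrite ltcE /= => /andP[/eqP im0 e0].
  have epsE : eps = (complex.Re eps)%:C by move: im0; case: (eps) => a b /= ->.
  have [T T1 hT] := weylz_large g e0.
  near=> x.
  have xT : x < - T by near: x; apply: nbhs_ninfty_lt; rewrite num_real.
  have Tx : T < - x by rewrite ltrNr.
  have x0 : x < 0 by rewrite -oppr_gt0 (lt_trans _ Tx) // (lt_trans _ T1).
  rewrite ME // oper_app_graph sub0r normrN rnormE epsE ltcR -fmorphV rnormZr.
  rewrite normfV ltr0_norm // ltr_pdivrMl ?oppr_gt0 // mulrC.
  exact: hT.
Unshelve. all: by end_near.
Qed.

(** * The formula for the Weyl function through the resolvent of B0 *)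

Section Factorization.
Hypothesis domS : oper_dom S1 `&` oper_dom S0 = oper_dom S.

Local Notation B0 := (oper_cayley S0).
Local Notation B1 := (oper_cayley S1).
Local Notation W := (oper_sqrt (B1 \-o B0)).
Local Notation N := (eigen_ker S' (-1)).

Variable X0 : oper K H.
Hypotheses (bX0 : bounded_oper X0) (ranX0 : oper_ran X0 = N).
Hypothesis lowX0 : exists k : R, forall h f, X0 (h, f) -> `|h| <= k%:C * `|f|.
Hypothesis gamX0 : gamma_field S S0 S1 G0 (-1) = W \oc X0.

Local Notation m := (weylz (-1)).
Local Notation x0 := (oper_app X0).

Let linX0 : linear_oper X0. Proof. by case: bX0. Qed.

Let X0P h : X0 (h, x0 h).
Proof. by apply: oper_appP; have [_ -> _] := bX0. Qed.

Lemma x0_linear : linear x0.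
Proof. by move=> a h k; apply: oper_app_linear => //; have [_ -> _] := bX0. Qed.

Lemma N_E x : N x <-> S' (x, - x).
Proof. by rewrite /eigen_ker /oper_ker /= oper_comp_id_sub add0r scaleN1r. Qed.

Lemma x0_N h : S' (x0 h, - x0 h).
Proof. by apply/N_E; rewrite -ranX0; exists h. Qed.

Lemma x0_onto x : S' (x, - x) -> exists h, x0 h = x.
Proof. by move=> /N_E; rewrite -ranX0 => -[h /(oper_appE linX0)]; exists h. Qed.

Lemma x0_low : exists2 c : R, 0 < c & forall h, rnorm h <= c * rnorm (x0 h).
Proof.
have [k hk] := lowX0; exists (`|k| + 1); first by rewrite ltr_wpDl.
move=> h; have := hk _ _ (X0P h); rewrite !rnormE -rmorphM lecR => /le_trans; apply.
by rewrite ler_wpM2r ?rnorm_ge0 // (le_trans (ler_norm k)) // lerDl.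
Qed.

Section Resolvents.
Variables (r0 r1 : H -> H).
Hypotheses (r0S0 : forall f, S0 (r0 f, f - r0 f)) (r1S1 : forall f, S1 (r1 f, f - r1 f)).
Hypotheses (r0K : forall u v, S0 (u, v) -> r0 (u + v) = u).
Hypotheses (r1K : forall u v, S1 (u, v) -> r1 (u + v) = u).
Hypotheses (sr0 : symmetric_fun r0) (sr1 : symmetric_fun r1).

Let C f : H := r1 f - (f - r1 f) - (r0 f - (f - r0 f)).

Let CE f : C f = 2%:R *: (r1 f - r0 f).
Proof.
rewrite /C scaler_nat mulr2n; apply: inner_ext => w.
by rewrite !(innerBl, innerDl); ring.
Qed.

Let symC : symmetric_fun C.
Proof. by move=> x y; rewrite /C !(innerBl, innerBr) sr0 sr1. Qed.

Lemma cayley_sub_graph : B1 \-o B0 = graph C.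
Proof. by rewrite (oper_cayleyE linS1 r1S1 r1K) (oper_cayleyE linS0 r0S0 r0K) oper_sub_graph. Qed.

Let r1D f : D1 (r1 f). Proof. exact: oper_dom_form_dom (r1S1 f). Qed.
Let r0D f : D0 (r0 f). Proof. exact: S0_D0 (r0S0 f). Qed.

Lemma form_inner_r1 f v : D1 v -> form_inner S1 (r1 f) v = inner H f v.
Proof.
by move=> Dv; rewrite /form_inner (form_operE saS1 nS1 (r1S1 f) Dv) -innerDl subrK.
Qed.

Lemma form_inner_r0 f v : D0 v -> form_inner S1 (r0 f) v = inner H f v.
Proof.
move=> Dv; have [_ h] := S01; rewrite /form_inner -h //.
by rewrite (form_operE saS0 nS0 (r0S0 f) Dv) -innerDl subrK.
Qed.

(** Against D[S0], where the two forms agree, both resolvents represent f, so their difference is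
    orthogonal to it. *)
Lemma resolvent_diff_E f : E (r1 f - r0 f).
Proof.
have Dd : D1 (r1 f - r0 f) by apply: lin_subspaceB; [| | exact: D01].
split => // v Dv; have D1v := D01 Dv; have Dr0 := D01 (r0D f).
rewrite form_innerE // form_isoB // innerBl -!form_innerE //.
by rewrite form_inner_r1 // form_inner_r0 // subrr.
Qed.

Lemma C_E f : E (C f).
Proof. by rewrite CE; apply: lin_subspaceZ;
  [exact: form_ortho_subspace | exact: resolvent_diff_E]. Qed.

(** The term [r0 f] lies in D[S0] and drops out against E, so on E the difference of resolvents is
    the Riesz representative of f. *)
Lemma form_inner_diff f e : E e -> form_inner S1 (r1 f - r0 f) e = inner H f e.
Proof.
move=> Ee; have De := E_D1 Ee; have Dr0 := D01 (r0D f).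
have Dd := E_D1 (resolvent_diff_E f).
have r0e : form_inner S1 (r0 f) e = 0 by rewrite form_inner_sym Ee.2 // rmorph0.
by rewrite form_innerE // form_isoB // innerBl -!form_innerE // r0e subr0 form_inner_r1.
Qed.

Lemma form_inner_C f e : E e -> form_inner S1 (C f) e = 2%:R * inner H f e.
Proof.
move=> Ee; rewrite -form_inner_diff // CE.
have Dd := E_D1 (resolvent_diff_E f).
have := form_isoP saS1 nS1 2%:R Dd sD1.1.
have -> : j 0 = 0 by have := form_isoB sD1.1 sD1.1; rewrite !subrr.
rewrite !addr0 => jC; rewrite !form_innerE // ?jC ?innerZl //; try exact: E_D1.
by rewrite -CE; exact/E_D1/C_E.
Qed.

Lemma C_ge0 f : 0 <= rinner (C f) f.
Proof.
have Ed := resolvent_diff_E f; have Dd := E_D1 Ed.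
have two : (2%:R : R[i]) = (2%:R : R)%:C by rewrite rmorph_nat.
rewrite CE two rinnerZl mulr_ge0 //.
by rewrite rinnerC /rinner -form_inner_diff // form_innerE // innerE sqr_ge0.
Qed.

Variable w : H -> H.
Hypotheses (sw : symmetric_fun w) (ww : forall x, w (w x) = C x).
Hypothesis gamw : forall h, gam h = w (x0 h).

Let lw : linear w. Proof. exact: symmetric_fun_linear. Qed.

(** The right-hand side says that q lies in the range of 1 + S. If w q = 0, the two resolvents agree
    at q, and their common value lies in dom S1 and dom S0, hence in dom S by [domS]. *)
Lemma w_eq0 q : w q = 0 <-> exists2 f, S (f, q - f) & True.
Proof.
split=> [wq|[f Sf _]].
  have Cq : C q = 0 by rewrite -ww wq linear_fun0.
  have e : r1 q = r0 q.
    apply/eqP; rewrite -subr_eq0; apply/eqP/(@scalerI _ _ (2%:R : R[i])).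
      by rewrite pnatr_eq0.
    by rewrite -CE Cq scaler0.
  have [f' Sf'] : oper_dom S (r0 q).
    rewrite -domS; split; last by exists (q - r0 q).
    by exists (q - r1 q); rewrite -e.
  exists (r0 q) => //; have [_ _ SF] := linS0.
  by rewrite -(SF _ _ _ (SS0 Sf') (r0S0 q)).
have e0 := r0K (SS0 Sf); have e1 := r1K (SS1 Sf).
rewrite [f + _]addrC subrK in e0 e1.
have Cq : C q = 0 by rewrite CE e0 e1 subrr scaler0.
apply: rnorm_eq0; apply/eqP; rewrite -sqrf_eq0 -rinner_sq /rinner sw ww Cq.
by rewrite inner0r.
Qed.

(** The range of the symmetric [w] is orthogonal to its kernel, which contains ran (1 + S). *)
Lemma w_N g : S' (w g, - w g).
Proof.
move=> f f' Sff'; apply/eqP; rewrite innerNr -addr_eq0 -innerDl -sw.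
have -> : w (f' + f) = 0 by apply/w_eq0; exists f; rewrite ?addrK.
by rewrite inner0l.
Qed.

Lemma N_orth_ker_w x q : S' (x, - x) -> w q = 0 -> inner H q x = 0.
Proof.
move=> Nx /w_eq0[f Sf _]; have := Nx _ _ Sf; rewrite innerNr innerBl.
by move=> /eqP; rewrite subr_eq addNr => /eqP.
Qed.

(** The residual q of the projection is orthogonal to ran w, so w q = 0 and q is orthogonal to x as
    well. Being a limit of vectors x - w g, it is orthogonal to itself. *)
Lemma w_dense x (eps : R) : S' (x, - x) -> 0 < eps ->
  exists g, rnorm (x - w g) < eps.
Proof.
move=> Nx eps0.
have sV : lin_subspace (range w).
  split; first by exists 0 => //; rewrite linear_fun0.
  by move=> a _ _ [u _ <-] [v _ <-]; exists (a *: u + v) => //; rewrite lw.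
have [q [qV qf]] := projection x sV.
have wq : w q = 0.
  by apply: inner_ext => g; rewrite sw inner0l; apply: qV; exists g.
have qx := N_orth_ker_w Nx wq.
suff q0 : q = 0.
  by have [_ [g _ <-] h] := qf eps eps0; exists g; rewrite q0 subr0 in h.
apply: rnorm_le_eps_eq0 => e e0; have [->|n0] := eqVneq (rnorm q) 0; first exact: ltW.
have {}n0 : 0 < rnorm q by rewrite lt_def n0 rnorm_ge0.
have [_ [g _ <-] h] := qf e e0.
rewrite -(ler_pM2r n0) -expr2.
have -> : rnorm q ^+ 2 = rinner (- (x - q - w g)) q.
  rewrite rinnerNl !rinnerBl rinner_sq rinnerC {1}/rinner qx.
  by rewrite [rinner (w g) q]rinnerC {1}/rinner qV ?subr0 ?sub0r ?opprK //; exists g.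
rewrite (le_trans (rinner_le _ _)) // rnormN ler_wpM2r ?rnorm_ge0 // ltW //.
Qed.

Lemma weylN1_C h g k : gam h = C g -> inner K (m h) k = - (2%:R * inner H g (gam k)).
Proof.
move=> e; rewrite -{1}(gamK k) weylN1E; last exact: gam_D1.
by rewrite e form_inner_C //; exact: gam_E.
Qed.

(* [X0^* X0 = - M(-1) / 2]: on the vectors that [X0] maps into the range of [w],
   both sides reduce to [w w = C]; these are dense by [w_dense]. *)
Lemma x0_inner h k : 2%:R * inner H (x0 h) (x0 k) = - inner K (m h) k.
Proof.
have [c c0 hc] := x0_low; have [c' c'0 hc'] := norm_bounded_pos (weylz_bounded off_halflineN1).
apply/eqP; rewrite -addr_eq0; apply/eqP; apply: complex_eq0 => a.
apply: (@le0_eps _ _ (normc (a * 2%:R) * rnorm (x0 k) + normc a * (c' * c) * rnorm k)).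
move=> e e0; have [g hg] := w_dense (x0_N h) e0.
have [h' xh'] := x0_onto (w_N g).
have gh' : gam h' = C g by rewrite gamw xh' ww.
have D0 : 2%:R * inner H (x0 h') (x0 k) + inner K (m h') k = 0.
  by rewrite (weylN1_C k gh') xh' sw -gamw subrr.
have -> : 2%:R * inner H (x0 h) (x0 k) + inner K (m h) k =
    2%:R * inner H (x0 h - w g) (x0 k) + inner K (m (h - h')) k.
  rewrite (linear_funB _ _ (weylz_linear off_halflineN1)) !innerBl -xh'.
  rewrite -[LHS]subr0 -D0; ring.
rewrite mulrDr ReD [leRHS]mulrDl lerD //.
  rewrite mulrA (le_trans (rinner_le_normc _ _ _)) // -!mulrA ler_wpM2l ?normc_ge0 //.
  by rewrite mulrC ler_wpM2l ?rnorm_ge0 // ltW.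
rewrite (le_trans (rinner_le_normc _ _ _)) // -!mulrA ler_wpM2l ?normc_ge0 //.
have h1 : rnorm (h - h') <= c * e.
  rewrite (le_trans (hc _)) // ler_pM2l // (linear_funB _ _ x0_linear) xh' ltW //.
rewrite [leRHS](_ : _ = c' * (c * e) * rnorm k); last by ring.
by rewrite ler_wpM2r ?rnorm_ge0 // (le_trans (hc' _)) // ler_pM2l.
Qed.

(** Since 1 + (1 - z) / (1 + z) = 2 / (1 + z), the operator B0 - (1 - z) / (1 + z) equals -2 / (1 +
    z) (1 + S0)^-1 (S0 - z), and [rho z] is its inverse. It vanishes at z = -1, in agreement with
    the convention at infinity. *)
Let rho z e := - ((1 + z) / 2%:R) *: (e + (1 + z) *: res z e).

Lemma resolventP z e y : off_halfline z ->
  resolvent B0 (cayley_point z) (e, y) <-> y = rho z e.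
Proof.
move=> zo; have lr0 := symmetric_fun_linear sr0.
rewrite /cayley_point; have [z1|z1] := eqVneq z (-1).
  by rewrite /resolvent /oper_zero /rho z1 subrr mul0r oppr0 scale0r.
have z1' : 1 + z != 0 by rewrite addrC addr_eq0.
rewrite /resolvent (oper_cayleyE linS0 r0S0 r0K) /oper_inv /= oper_comp_id_sub /graph /=.
set a := (1 - z) / (1 + z).
have aE : 1 + a = 2%:R / (1 + z) by rewrite /a; field.
have r0rho : r0 (rho z e) = - ((1 + z) / 2%:R) *: res z e.
  rewrite /rho (linear_funZ _ _ lr0); congr (_ *: _).
  have := r0K (resP e zo); rewrite (_ : res z e + _ = e + (1 + z) *: res z e) //.
  by rewrite scalerDl scale1r addrCA.
have inB u : e + a *: u = r0 u - (u - r0 u) <-> e = 2%:R *: r0 u - (1 + a) *: u.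
  split=> h.
    apply: (@addIr _ (a *: u)); rewrite h; apply: inner_ext => v.
    by rewrite !(innerBl, innerDl, innerZl); ring.
  by rewrite h; apply: inner_ext => v; rewrite !(innerBl, innerDl, innerZl); ring.
have e_rho : e = 2%:R *: r0 (rho z e) - (1 + a) *: rho z e.
  rewrite r0rho aE /rho; apply: inner_ext => v.
  by rewrite !(innerBl, innerDl, innerZl); field.
rewrite inB; split => [|->] //; rewrite {1}e_rho => h.
(* Uniqueness: the difference satisfies d = (1 + z) r0 d, so r0 d solves S0 x = z x and is 0. *)
pose d := y - rho z e.
have hd : 2%:R *: r0 d = (1 + a) *: d.
  rewrite /d (linear_funB _ _ lr0) !scalerBr; apply/eqP; rewrite subr_eq.
  by rewrite -addrA [- _ + _]addrC h addrC subrK.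
have S0d := r0S0 d.
have dE : d = (1 + z) *: r0 d.
  have := congr1 (fun x => ((1 + z) / 2%:R) *: x) hd; rewrite !scalerA aE.
  rewrite divfK ?pnatr_eq0 // => ->; rewrite (_ : _ * _ = 1) ?scale1r //; field.
  by rewrite z1'.
have r0d0 : r0 d = 0.
  have [S00 _ _] := linS0; apply: (S0_inj zo S0d S00).
  rewrite {1}dE scalerDl scale1r [r0 d + _]addrC addrK.
  by rewrite subrr scaler0 subr0.
by apply/eqP; rewrite -subr_eq0 -/d dE r0d0 scaler0.
Qed.

Hypothesis WE : W = graph w.

(** Paired with [gam k], the resolvent part of u(z) is orthogonal in the form inner product. What
    remains of the Green identity is -(gam h, gam k) in that inner product plus (1 + z) (u(z), gam
    k) in H. The second term comes from h', because rho z (gam h) = -(1 + z) / 2 u(z). *)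
Lemma weyl_rho z h h' : off_halfline z -> gam h' = C (rho z (gam h)) ->
  weylz z h = m (h + h').
Proof.
move=> zo gh'; apply: inner_ext => k; rewrite -(gamK k).
rewrite (linear_funD _ _ (weylz_linear off_halflineN1)) innerDl.
rewrite [in X in _ + X]gamK (weylN1_C k gh') weylN1E ?weylzE //; try exact: gam_D1.
have Er := (gam_E k).2 _ (res_D0 (gam h) zo).
have := congr1 Num.conj Er; rewrite -form_inner_sym rmorph0 => {}Er.
have D1r := D01 (res_D0 (gam h) zo).
have -> : form S1 (gamz z h) (gam k) =
    form_inner S1 (gam h) (gam k) - inner H (gamz z h) (gam k).
  have := form_isoP saS1 nS1 (1 + z) D1r (gam_D1 h); rewrite addrC -/(gamz z h) => jg.
  have -> : form S1 (gamz z h) (gam k) =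
     form_inner S1 (gamz z h) (gam k) - inner H (gamz z h) (gam k).
    by rewrite /form_inner addrK.
  have [Dh Dk Dz] : [/\ D1 (gam h), D1 (gam k) & D1 (gamz z h)].
    by split; [exact: gam_D1 | exact: gam_D1 | exact: gamz_D1].
  by rewrite form_innerE // jg innerDl innerZl -!form_innerE // Er mulr0 add0r.
by rewrite /rho /gamz !(innerDl, innerZl); field.
Qed.

Lemma weyl_formula z : off_halfline z ->
  M z = (-2) \:o (adjoint X0 \oc
    (oper_id H \+o (W \oc resolvent B0 (cayley_point z) \oc W)) \oc X0).
Proof.
move=> zo; rewrite weyl_functionE // WE.
have adjX0 x y y' : adjoint X0 (x, y) -> adjoint X0 (x, y') -> y = y'.
  move=> h h'; apply: inner_extr => k.
  by rewrite -(h _ _ (X0P k)) -(h' _ _ (X0P k)).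
(* As w maps into the range of X0, the argument is X0 (h + h'); then X0^* X0 = -M(-1) / 2 and
   [weyl_rho] conclude. *)
have key h : adjoint X0 (x0 h + w (rho z (gam h)), - (2%:R^-1 : R[i]) *: weylz z h).
  have [h' xh'] := x0_onto (w_N (rho z (gam h))).
  have gh' : gam h' = C (rho z (gam h)) by rewrite gamw xh' ww.
  rewrite -xh' (weyl_rho zo gh') => k _ /(oper_appE linX0) <-.
  rewrite -(linear_funD _ _ x0_linear) innerC [RHS]innerC; congr Num.conj.
  apply: (@mulfI _ (2%:R : R[i])); first by rewrite pnatr_eq0.
  by rewrite x0_inner innerZl mulrA mulrN divff ?pnatr_eq0 // mulN1r.
apply/seteqP; split=> -[h y]; rewrite /graph /=.
  move=> ->; exists (- (2%:R^-1 : R[i]) *: weylz z h).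
    exists (x0 h); first exact: X0P.
    exists (x0 h + w (rho z (gam h))); last exact: key.
    exists (x0 h), (w (rho z (gam h))); split => //.
    exists (gam h); first by rewrite gamw.
    by exists (rho z (gam h)) => //; apply/resolventP.
  by rewrite /= scalerA mulrN mulNr opprK divff ?pnatr_eq0 // scale1r.
move=> [y' [x /= /(oper_appE linX0) <-] [x' [a [b [aE [e eE [r rE bE]] x'E]]] ad] ->].
move: aE eE rE bE x'E ad; rewrite /oper_id /= => -> -> + ->.
rewrite -gamw resolventP // => -> -> /(adjX0 _ _ _ (key h)) <-.
by rewrite scalerA mulrN mulNr opprK divff ?pnatr_eq0 // scale1r.
Qed.

End Resolvents.

Lemma weyl_factorization z : off_halfline z ->
  M z = (-2) \:o (adjoint X0 \oc
    (oper_id H \+o (W \oc resolvent B0 (cayley_point z) \oc W)) \oc X0).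
Proof.
have [r0 [r0S0 r0K sr0 _]] := nonneg_resolvent saS0 nS0.
have [r1 [r1S1 r1K sr1 _]] := nonneg_resolvent saS1 nS1.
have sC : symmetric_fun (fun f => r1 f - (f - r1 f) - (r0 f - (f - r0 f))).
  by move=> x y; rewrite !(innerBl, innerBr) sr0 sr1.
have [w [+ sw ww]] := oper_sqrt_graph sC (C_ge0 r0S0 r1S1).
rewrite -(cayley_sub_graph r0S0 r1S1 r0K r1K) => WE.
apply: (weyl_formula r0S0 r1S1 r0K r1K sr0 sw ww) => // h.
have : gamma_field S S0 S1 G0 (-1) (h, gam h).
  by rewrite gamma_fieldE ?/graph /= ?gamzN1 //; exact: off_halflineN1.
by rewrite gamX0 WE => -[x /= /(oper_appE linX0) -> ].
Qed.

(** The restriction to N is harmless after X0, whose range is N. *)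
Lemma comp_qfun_restr z :
  adjoint X0 \oc qfun N B0 B1 (cayley_point z) \oc X0 =
  adjoint X0 \oc (oper_id H \+o (W \oc resolvent B0 (cayley_point z) \oc W)) \oc X0.
Proof.
apply/seteqP; split=> -[h y] [x X0x [x' hx' ad]]; exists x => //; exists x' => //.
  by case: hx'.
by split => //; rewrite -ranX0; exists h.
Qed.

End Factorization.

End BoundaryTriplet.

Theorem theorem7p17 (R : realType) (H K : hilbertSpace R)
    (S S0 S1 : oper H H) (G0 G1 : oper H K) :
  separable H ->
  (* S : densely defined nonnegative symmetric operator *)
  linear_oper S -> densely_defined S -> symmetric_oper S -> nonneg_oper S ->
  (* S0, S1 : nonnegative selfadjoint extensions of S *)
  selfadjoint S0 -> nonneg_oper S0 -> S `<=` S0 ->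
  selfadjoint S1 -> nonneg_oper S1 -> S `<=` S1 ->
  oper_dom S1 `&` oper_dom S0 = oper_dom S ->
  closed_form_restriction S0 S1 ->
  boundary_pair S0 S1 G0 ->
  boundary_triplet S S0 S1 G0 G1 ->
  let B0 := oper_cayley S0 in
  let B1 := oper_cayley S1 in
  let W := oper_sqrt (B1 \-o B0) in
  let N := eigen_ker (adjoint S) (-1) in
  let M := weyl_function S S0 S1 G0 G1 in
  (forall X0 : oper K H,
     (* X0 : continuous linear isomorphism from K onto N *)
     bounded_oper X0 -> oper_ran X0 = N ->
     (exists k : R, forall h f, X0 (h, f) -> `|h| <= k%:C * `|f|) ->
     gamma_field S S0 S1 G0 (-1) = W \oc X0 ->
     forall z : R[i], off_halfline z ->
       M z = (-2) \:o (adjoint X0 \oc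
               (oper_id H \+o (W \oc resolvent B0 (cayley_point z) \oc W))
               \oc X0)
       /\
       M z = (-2) \:o (adjoint X0 \oc qfun N B0 B1 (cayley_point z) \oc X0))
  /\
  (S0 `&` S1 = S ->
   (forall u, form_dom S1 u ->
      inf [set qform S1 (u - f) | f in form_dom S0] = 0) ->
   class_SF M).
Proof.
move=> _ _ dS _ _ saS0 nS0 SS0 saS1 nS1 SS1 domS S01 _ triplet B0 B1 W N M.
split=> [X0 bX0 ranX0 lowX0 gamX0 z zo|_ inf0].
  have ME := weyl_factorization dS saS0 nS0 SS0 saS1 nS1 SS1 S01 triplet domS
    bX0 ranX0 lowX0 gamX0 zo.
  by split; rewrite /M ?comp_qfun_restr.
exact: weyl_class_SF.
Qed.
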